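(* Let $X=X(\Sigma)$ be a complete simplicial $n$-dimensional normal toric variety over a field $\mathbf{k}$, with Cox ring $S=\mathbf{k}[\Sigma]$ and irrelevant ideal $B\subset S$. Let $I\subset S$ be a non-irrelevant $B$-saturated monomial ideal. Then there exists a monomial ideal $J\subset S$ with $I=J:B^{\infty}$ and $\operatorname{pdim} S/J\leq n$.
   Context: $\Sigma$ is the fan of $X$ in an $n$-dimensional lattice; a cone is identified with its set of extremal rays, so faces of a (simplicial) cone correspond to subsets of its rays. The Cox ring $S=\mathbf{k}[\Sigma]$ is the polynomial ring with one variable $x_\rho$ for each ray $\rho$ of $\Sigma$. For a collection of rays $\sigma$, $x_{\widehat{\sigma}}:=\prod_{\rho\notin\sigma}x_\rho$. The irrelevant ideal is $B=\langle x_{\widehat{\sigma}} \mid \sigma\in\Sigma\rangle$. For an ideal $J$, $J:B^{\infty}=\bigcup_{\ell\ge 0}(J:B^{\ell})$; $I$ is $B$-saturated if $I:B^{\infty}=I$. An ideal is non-irrelevant if it contains no power of $B$ (for a $B$-saturated ideal $I$ this means $I\neq S$). $\operatorname{pdim}$ denotes projective dimension over $S$. *)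

(* Defs.v *)
From HB Require Import structures.
From mathcomp Require Import all_boot all_order all_algebra.
From mathcomp Require Import boolp classical_sets reals.
From mathcomp Require Import mpoly.

Set Implicit Arguments.
Unset Strict Implicit.
Unset Printing Implicit Defensive.

Import GRing.Theory.

Local Open Scope ring_scope.
Local Open Scope classical_set_scope.
Local Open Scope quotient_scope.

(* Rational polyhedral cones in N_R, for the lattice N = Z^n. A cone is given *)
(* by the set of (indices of) its rays.                                       *)

Section Cones.
Variables (R : realType) (n r : nat) (u : 'I_r -> 'rV[int]_n).
Implicit Types s t : {set 'I_r}.

Definition real_ray (i : 'I_r) : 'rV[R]_n := map_mx intr (u i).

Definition cone s : set 'rV[R]_n :=
  [set v | exists2 c : 'I_r -> R,
     forall i, 0 <= c i & v = \sum_(i in s) c i *: real_ray i].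

Definition pairing (v : 'rV[R]_n) (m : 'cV[R]_n) : R := (v *m m) 0 0.

(* [cone t] is the intersection of [cone s] with the hyperplane orthogonal to *)
(* some [m] in the dual cone of [cone s], and [t] consists of all the         *)
(* generators of [s] lying on that hyperplane.                                *)
Definition is_face t s : Prop :=
  exists2 m : 'cV[R]_n,
    forall i, i \in s -> 0 <= pairing (real_ray i) m
    & forall i, (i \in t) = (i \in s) && (pairing (real_ray i) m == 0).

Definition strongly_convex s : Prop :=
  forall v, cone s v -> cone s (- v) -> v = 0.

Definition primitive (v : 'rV[int]_n) : Prop :=
  (\big[gcdn/0]_(j < n) `|v 0%R j|)%N = 1%N.

End Cones.

Arguments cone R {n r} u s _.

Record fan (R : realType) (n r : nat) := Fan {
  fan_ray : 'I_r -> 'rV[int]_n;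
  fan_cones : {set {set 'I_r}};
  fan_ray_primitive : forall i, primitive (fan_ray i);
  fan_ray_mem : forall i, [set i]%SET \in fan_cones;
  fan_strongly_convex : forall s, s \in fan_cones ->
    strongly_convex R fan_ray s;
  fan_ray_extremal : forall s i, s \in fan_cones -> i \in s ->
    is_face R fan_ray [set i]%SET s;
  fan_face : forall s t, s \in fan_cones -> is_face R fan_ray t s ->
    t \in fan_cones;
  fan_meet : forall s t, s \in fan_cones -> t \in fan_cones ->
    exists2 w, is_face R fan_ray w s /\ is_face R fan_ray w t
      & cone R fan_ray s `&` cone R fan_ray t = cone R fan_ray w
}.

Definition complete_fan (R : realType) (n r : nat) (F : fan R n r) : Prop :=
  forall v : 'rV[R]_n, exists2 s, s \in fan_cones F & cone R (fan_ray F) s v.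

Definition simplicial_fan (R : realType) (n r : nat) (F : fan R n r) : Prop :=
  forall s, s \in fan_cones F ->
    free [seq real_ray R (fan_ray F) i | i <- enum s].

Section Ideals.
Variable S : comNzRingType.
Implicit Types (A B : set S).

Definition is_ideal A : Prop :=
  [/\ A 0, forall x y, A x -> A y -> A (x + y) & forall a x, A x -> A (a * x)].

Record ideal := Ideal { ideal_set :> set S; ideal_axiom : is_ideal ideal_set }.

Definition ideal_gen (G : set S) : set S := smallest is_ideal G.

Definition ideal_mul A B : set S :=
  ideal_gen [set z | exists x y, [/\ A x, B y & z = x * y]].

Fixpoint ideal_exp A (l : nat) : set S :=
  if l is l'.+1 then ideal_mul A (ideal_exp A l') else setT.

Definition colon A B : set S := [set f | forall g, B g -> A (f * g)].

Definition saturation A B : set S := \bigcup_(l in setT) colon A (ideal_exp B l).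

Definition saturated A B : Prop := saturation A B = A.

Definition non_irrelevant A B : Prop := forall l, ~ ideal_exp B l `<=` A.

End Ideals.

Section QuotientModule.
Variables (S : comNzRingType) (J : ideal S).

Definition ideal_pred : pred S := fun x => `[< ideal_set J x >].

Fact ideal_pred_zmod : zmod_closed (ideal_pred : {pred S}).
Proof.
case: (ideal_axiom J) => J0 JD JM; split=> [|x y]; first exact/asboolP.
move=> /asboolP Jx /asboolP Jy; apply/asboolP; apply: (JD) => //.
by rewrite -mulN1r; apply: JM.
Qed.

HB.instance Definition _ := GRing.isZmodClosed.Build S ideal_pred ideal_pred_zmod.

Local Notation addquot := (Quotient.quot (GRing.ZmodClosed.clone S ideal_pred _)).

Definition quot_mod : Type := addquot.
HB.instance Definition _ := GRing.Zmodule.on quot_mod.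

Definition quot_proj (x : S) : quot_mod := \pi_addquot x.

Fact quot_proj_eq x y : (quot_proj x = quot_proj y) <-> ideal_set J (x - y).
Proof.
rewrite /quot_proj; split=> [/eqP|Jxy].
  by rewrite -Quotient.idealrBE => /asboolP.
by apply/eqP; rewrite -Quotient.idealrBE; apply/asboolP.
Qed.

Fact quot_projD x y : quot_proj (x + y) = quot_proj x + quot_proj y.
Proof. exact: raddfD. Qed.

Fact quot_proj_repr (q : quot_mod) : quot_proj (repr (q : addquot)) = q.
Proof. exact: reprK. Qed.

Definition quot_scale (a : S) (q : quot_mod) : quot_mod :=
  quot_proj (a * repr (q : addquot)).

Fact quot_scale_proj a x : quot_scale a (quot_proj x) = quot_proj (a * x).
Proof.
case: (ideal_axiom J) => _ _ JM.
apply/quot_proj_eq; rewrite -mulrBr; apply/JM/quot_proj_eq.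
exact: quot_proj_repr.
Qed.

Fact quot_scaleA a b q : quot_scale a (quot_scale b q) = quot_scale (a * b) q.
Proof. by rewrite -(quot_proj_repr q) !quot_scale_proj mulrA. Qed.

Fact quot_scale1 : left_id 1 quot_scale.
Proof. by move=> q; rewrite -(quot_proj_repr q) quot_scale_proj mul1r. Qed.

Fact quot_scaleDr : right_distributive quot_scale +%R.
Proof.
move=> a p q; rewrite -(quot_proj_repr p) -(quot_proj_repr q).
by rewrite -quot_projD !quot_scale_proj mulrDr quot_projD.
Qed.

Fact quot_scaleDl q : {morph quot_scale^~ q : a b / a + b}.
Proof.
move=> a b; rewrite -(quot_proj_repr q) !quot_scale_proj.
by rewrite mulrDl quot_projD.
Qed.

HB.instance Definition _ := GRing.Zmodule_isLmodule.Build S quot_mod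
  quot_scaleA quot_scale1 quot_scaleDr quot_scaleDl.

End QuotientModule.

Section ProjectiveDimension.
Variable S : nzRingType.

Definition surjective_map (T U : Type) (f : T -> U) : Prop :=
  forall y, exists x, f x = y.

Definition projective (P : lmodType S) : Prop :=
  forall (M N : lmodType S) (g : {linear M -> N}) (f : {linear P -> N}),
    surjective_map g -> exists h : {linear P -> M}, forall x, g (h x) = f x.

(* There is a projective resolution                                           *)
(*   0 -> P d -> ... -> P 1 -> P 0 -> M -> 0.                                 *)
Definition pdim_le (M : lmodType S) (d : nat) : Prop :=
  exists (P : nat -> lmodType S)
         (bd : forall i, {linear P i.+1 -> P i})
         (aug : {linear P 0%N -> M}),
    [/\ forall i, projective (P i),
        surjective_map aug,
        forall x, aug x = 0 <-> exists y, bd 0%N y = x,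
        forall i x, bd i x = 0 <-> exists y, bd i.+1 y = x
      & forall i, (d < i)%N -> forall x : P i, x = 0].

End ProjectiveDimension.

Section CoxRing.
Variables (k : fieldType) (r : nat).

Definition monomial_ideal (A : set {mpoly k[r]}) : Prop :=
  exists M : set 'X_{1..r}, A = ideal_gen [set 'X_[m] | m in M].

Definition xhat (s : {set 'I_r}) : {mpoly k[r]} := \prod_(i | i \notin s) 'X_i.

Definition irrelevant_ideal (R : realType) (n : nat) (F : fan R n r) :
    set {mpoly k[r]} :=
  ideal_gen [set xhat s | s in [set s | s \in fan_cones F]].

End CoxRing.

Arguments irrelevant_ideal k {r R n} F _.

(* Main.v *)
(** The module S/J is controlled by linear quotients: if J is obtained from the
    zero ideal by successively adding monomials m such that each colon ideal
    (J_old : m) is generated by at most n - 1 variables, then the mapping cones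
    of Koszul complexes give pdim S/J <= n.

    Fix a ray rho and a bound a such that membership of a monomial x^m in I only
    depends on the exponents of m truncated at a.  Let J be spanned by the
    x^m in I whose set of low rays { o <> rho | m_o < a } is a cone.  Since J
    contains x_(hat sigma)^a I for every cone sigma and B^l is contained in
    the ideal of the a-th powers of the x_(hat sigma) for l large, the saturation
    of J is I.

    To add the monomials of J in a good order, sort them first by the least
    exponent e of x_rho that keeps m in I.  For e > 0, lowering that exponent to
    e - 1 leaves I because of the coordinates of m along a face G with G + rho a
    cone (this uses that I is saturated).  Among the cones through G and not
    through rho, the maximal ones can be removed one at a time along free ridges
    containing G: a generic path from one of these cones to rho must leave their
    union through such a ridge.  Each removed pair (cone, ridge) contributes
    monomials whose colon variables are the n - 1 rays of the ridge. *)

From HB Require Import structures.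
Require Import Defs.
From mathcomp Require Import all_boot all_order all_algebra.
From mathcomp Require Import boolp classical_sets reals.
From mathcomp Require Import mpoly.
From mathcomp Require Import ring lra.

Set Implicit Arguments.
Unset Strict Implicit.
Unset Printing Implicit Defensive.

Import Order.TTheory GRing.Theory Num.Theory.

Local Open Scope ring_scope.

(** * Projective modules and resolutions of cokernels *)

Section Projective.
Variable S : nzRingType.
Implicit Types M N P : lmodType S.

Section Pullback.
Variables (M N P : lmodType S) (g : {linear M -> N}) (f : {linear P -> N}).

Definition pullback_pred : pred (M * P)%type := fun x => `[< g x.1 = f x.2 >].

Fact pullback_submod : submod_closed (pullback_pred : {pred (M * P)%type}).
Proof.
split=> [|c x y /asboolP ex /asboolP ey]; apply/asboolP; first by rewrite !linear0.
by rewrite /= !linearP ex ey.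
Qed.

HB.instance Definition _ :=
  GRing.isSubmodClosed.Build S (M * P)%type pullback_pred pullback_submod.

Definition pullback : Type := {x : (M * P)%type | x \in pullback_pred}.
HB.instance Definition _ := SubChoice.on pullback.
HB.instance Definition _ := [SubChoice_isSubLmodule of pullback by <:].

Definition pullback1 (x : pullback) : M := (val x).1.
Definition pullback2 (x : pullback) : P := (val x).2.

Fact pullback1_linear : linear pullback1.
Proof. by move=> c x y; rewrite /pullback1 linearP. Qed.
HB.instance Definition _ := GRing.isLinear.Build S pullback M _ pullback1 pullback1_linear.

Fact pullback2_linear : linear pullback2.
Proof. by move=> c x y; rewrite /pullback2 linearP. Qed.
HB.instance Definition _ := GRing.isLinear.Build S pullback P _ pullback2 pullback2_linear.

(** Projectivity lifts only along surjections. Since [g] covers the image of [f], [pullback2] is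
    surjective and has a linear section; composing it with [pullback1] gives the lift. *)
Lemma projective_lift : projective P -> (forall x, exists y, g y = f x) ->
  exists h : {linear P -> M}, forall x, g (h x) = f x.
Proof.
move=> projP fg; have [|h hE] := projP pullback P pullback2 idfun.
  move=> x; have [y gy] := fg x.
  have xyP : (y, x) \in pullback_pred by apply/asboolP.
  by exists (exist _ (y, x) xyP).
exists (pullback1 \o h)%FUN => x /=.
by rewrite -{2}[x]hE; apply/asboolP/(valP (h x)).
Qed.

End Pullback.


Definition prod_inl M N (x : M) : M * N := (x, 0).
Definition prod_inr M N (y : N) : M * N := (0, y).

Fact prod_inl_linear M N : linear (@prod_inl M N).
Proof. by move=> c x y; apply/eqP; rewrite xpair_eqE /= ?scaler0 ?addr0 !eqxx. Qed.
HB.instance Definition _ M N :=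
  GRing.isLinear.Build S M (M * N)%type _ (@prod_inl M N) (@prod_inl_linear M N).

Fact prod_inr_linear M N : linear (@prod_inr M N).
Proof. by move=> c x y; apply/eqP; rewrite xpair_eqE /= ?scaler0 ?addr0 !eqxx. Qed.
HB.instance Definition _ M N :=
  GRing.isLinear.Build S N (M * N)%type _ (@prod_inr M N) (@prod_inr_linear M N).

Lemma prod_inlr M N (x : M) (y : N) : prod_inl N x + prod_inr M y = (x, y).
Proof. by congr pair; rewrite ?addr0 ?add0r. Qed.

Lemma projective_prod M N : projective M -> projective N -> projective (M * N)%type.
Proof.
move=> pM pN A B g f gs.
have [h1 h1E] := pM _ _ g (f \o @prod_inl M N)%FUN gs.
have [h2 h2E] := pN _ _ g (f \o @prod_inr M N)%FUN gs.
exists ((h1 \o fst) \+ (h2 \o snd))%FUN => -[x y] /=.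
by rewrite linearD h1E h2E /= -linearD prod_inlr.
Qed.

Lemma projective_regular : projective S^o.
Proof.
move=> M N g f gs; have [y gy] := gs (f 1).
have lin : linear (fun x : S^o => x *: y : M).
  by move=> c x z; rewrite scalerDl scalerA.
pose h : {linear S^o -> M} := HB.pack (fun x : S^o => x *: y : M)
  (GRing.isLinear.Build S S^o M _ _ lin).
by exists h => x; rewrite linearZ /= gy -linearZ /=; congr (f _); exact: mulr1.
Qed.

Lemma projective_trivial P : (forall x : P, x = 0) -> projective P.
Proof.
by move=> P0 M N g f _; exists (\0 : {linear P -> M}) => x; rewrite (P0 x) !linear0.
Qed.


(* The resolution of the cokernel is the mapping cone of a lift of [phi] to the
   resolutions, so its term in degree [i + 1] is [B i.+1 * A i]. *)
Lemma pdim_le_cokernel M N P (phi : {linear M -> N}) (psi : {linear N -> P}) d n :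
  injective phi -> surjective_map psi ->
  (forall x, psi x = 0 <-> exists y, phi y = x) -> (d < n)%N ->
  pdim_le M d -> pdim_le N n -> pdim_le P n.
Proof.
move=> phi_inj psi_surj exN ltdn.
move=> [A [dA [eA [projA eA_surj exA0 exA Abound]]]].
move=> [B [dB [eB [projB eB_surj exB0 exB Bbound]]]].
have [h0 h0E] : exists h : {linear A 0%N -> B 0%N}, forall x, eB (h x) = phi (eA x).
  have [|h hE] := @projective_lift _ _ _ eB (phi \o eA)%FUN (projA 0%N).
    by move=> x; apply: eB_surj.
  by exists h.
pose lifts i (h : {linear A i -> B i}) := forall y, exists z, dB i z = h (dA i y).
have lifts0 : lifts 0%N h0.
  move=> y; apply/exB0; rewrite h0E (_ : eA _ = 0) ?linear0 //.
  by apply/exA0; exists y.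
(* Each lift is carried together with the proof that it can be lifted once more, which is what the
   recursion [H] needs to continue. *)
have step i (h : {h | lifts i h}) : {h' : {h' | lifts i.+1 h'} |
    forall y, dB i (sval h' y) = sval h (dA i y)}.
  apply: cid; case: h => h /= hl.
  have [h' h'E] := projective_lift (f := (h \o dA i)%FUN) (projA i.+1) hl.
  have h'l : lifts i.+1 h'.
    move=> y; apply/exB; rewrite h'E /= (_ : dA i _ = 0) ?linear0 //.
    by apply/exA; exists y.
  by exists (exist _ h' h'l).
pose H := fix H i : {h | lifts i h} :=
  if i is i'.+1 then sval (step i' (H i')) else exist _ h0 lifts0.
pose h i : {linear A i -> B i} := sval (H i).
have hE i y : dB i (h i.+1 y) = h i (dA i y) := svalP (step i (H i)) y.
have {}h0E x : eB (h 0%N x) = phi (eA x) := h0E x.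
clearbody h; clear H step lifts0 lifts h0.
pose C i : lmodType S := if i is j.+1 then (B j.+1 * A j)%type : lmodType S else B 0%N.
pose dC0 : {linear C 1%N -> C 0%N} := ((dB 0%N \o fst) \+ (h 0%N \o snd))%FUN.
pose dC1 i : {linear C i.+2 -> C i.+1} :=
  ((@prod_inl _ _ \o ((dB i.+1 \o fst) \+ (h i.+1 \o snd)))
   \- (@prod_inr _ _ \o (dA i \o snd)))%FUN.
pose dC i : {linear C i.+1 -> C i} := if i is j.+1 then dC1 j else dC0.
have dC1E i (b : B i.+2) (a : A i.+1) :
    dC i.+1 (b, a) = (dB i.+1 b + h i.+1 a, - dA i a).
  rewrite -prod_inlr /= /prod_inr /=.
  by apply/eqP; rewrite xpair_eqE /= oppr0 !addr0 sub0r add0r !eqxx.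
exists C, dC, (psi \o eB)%FUN; split.
- by case=> [|i] /=; [apply: projB | apply: projective_prod].
- by move=> y; have [x <-] := psi_surj y; have [z <-] := eB_surj x; exists z.
- move=> x /=; split=> [/exN[y phiy]|[[b a] <-]].
    have [a aE] := eA_surj y.
    have /exB0[b bE] : eB (x - h 0%N a) = 0 by rewrite linearB /= h0E aE phiy subrr.
    by exists (b, a); rewrite /= bE subrK.
  apply/exN; exists (eA a); rewrite /= linearD /= h0E.
  by rewrite (_ : eB (dB _ _) = 0) ?add0r //; apply/exB0; exists b.
- move=> i [b a]; split=> [|[[b' a'] <-]]; last first.
    rewrite dC1E; case: i b a b' a' => [|i] b a b' a'.
      rewrite /= linearD linearN /= hE addrK.
      by apply/exB; exists b'.
    rewrite dC1E; congr pair.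
      rewrite linearD linearN /= hE addrK.
      by apply/exB; exists b'.
    by rewrite linearN (_ : dA i _ = 0) ?oppr0 //; apply/exA; exists a'.
  (* A cycle [(b, a)] is a boundary as soon as [a] is one. For positive [i] this comes from the
     second component; for [i = 0] it comes from the injectivity of [phi]. *)
  suff fill : dB i b + h i a = 0 -> (exists a', dA i a' = a) ->
      exists x, dC i.+1 x = (b, a).
    case: i b a fill => [|i] b a fill.
      move=> dba0; have {}dba0 : dB 0%N b + h 0%N a = 0 := dba0.
      apply: (fill dba0); apply/exA0; apply: phi_inj; rewrite linear0 -h0E.
      have e0 : eB (dB 0%N b) = 0 by apply/exB0; exists b.
      by have := congr1 eB dba0; rewrite linearD e0 add0r linear0.
    rewrite dC1E => /eqP; rewrite xpair_eqE oppr_eq0 => /andP[/eqP dba /eqP da0].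
    by apply: fill => //; apply/exA.
  move=> dba [a' aE]; have /exB[b' bE] : dB i (b + h i.+1 a') = 0.
    by rewrite linearD /= hE aE.
  by exists (b', - a'); rewrite dC1E !linearN /= bE aE opprK addrK.
- case=> [|i] /= lt_ni x; first exact: Bbound.
  case: x => b a; rewrite (Bbound _ lt_ni b) (Abound i _ a) //.
  exact: leq_trans ltdn _.
Qed.

End Projective.

(** * Quotients of the ring by ideals, and the effect of one more generator *)

Section CyclicModules.
Variable S : comNzRingType.
Implicit Types J C : ideal S.

Lemma ideal_eq J C : (forall x, ideal_set J x <-> ideal_set C x) -> J = C.
Proof.
case: J C => J HJ [C HC] /= JC.
have {}JC : J = C by apply/seteqP; split=> x /JC.
by case: C / JC HC => HC; congr Ideal; apply: Prop_irrelevance.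
Qed.

Lemma quot_projZ J c x : c *: quot_proj J x = quot_proj J (c * x).
Proof. exact: quot_scale_proj. Qed.

Lemma quot_proj_surj J : surjective_map (quot_proj J).
Proof. by move=> q; eexists; apply: quot_proj_repr. Qed.

Lemma quot_proj_eq0 J x : quot_proj J x = 0 <-> ideal_set J x.
Proof.
rewrite -[x in ideal_set J x]subr0 -quot_proj_eq.
suff -> : quot_proj J 0 = 0 by [].
by apply: (addrI (quot_proj J 0)); rewrite -quot_projD !addr0.
Qed.

Lemma quot_mul_map J C f : (forall x, ideal_set J x -> ideal_set C (x * f)) ->
  exists phi : {linear quot_mod J -> quot_mod C},
    forall x, phi (quot_proj J x) = quot_proj C (x * f).
Proof.
move=> JC; have /choice[g gE] : forall q, exists y, exists2 x, quot_proj J x = q &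
    y = quot_proj C (x * f).
  by move=> q; have [x xq] := quot_proj_surj q; exists (quot_proj C (x * f)), x.
have gP x : g (quot_proj J x) = quot_proj C (x * f).
  have [y /quot_proj_eq yx ->] := gE (quot_proj J x).
  by apply/quot_proj_eq; rewrite -mulrBl; apply: JC.
have g_lin : linear g.
  move=> c q1 q2; have [x <-] := quot_proj_surj q1; have [y <-] := quot_proj_surj q2.
  by rewrite quot_projZ -quot_projD !gP quot_projZ -quot_projD mulrDl mulrA.
by exists (HB.pack_for {linear quot_mod J -> quot_mod C} g
  (GRing.isLinear.Build S (quot_mod J) (quot_mod C) _ g g_lin)).
Qed.

(** Here [C] is the colon ideal of [J] by [f], and [J'] is [J] plus the ideal of [f]; multiplication
    by [f] gives the exact sequence 0 -> S/C -> S/J -> S/J' -> 0. *)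
Lemma pdim_le_quot_add J C J' f d n :
    (forall x, ideal_set C x <-> ideal_set J (x * f)) ->
    (forall y, ideal_set J' y <-> exists x, ideal_set J (y - x * f)) ->
    (d < n)%N -> pdim_le (quot_mod C) d -> pdim_le (quot_mod J) n ->
  pdim_le (quot_mod J') n.
Proof.
move=> CE J'E ltdn.
have [phi phiE] := quot_mul_map (fun x => (CE x).1).
have [|psi psiE] := @quot_mul_map J J' 1.
  by move=> x Jx; rewrite mulr1 J'E; exists 0; rewrite mul0r subr0.
apply: (@pdim_le_cokernel _ _ _ _ phi psi) => //.
- move=> p q /eqP; rewrite -subr_eq0 -linearB /= => /eqP phi0.
  apply/eqP; rewrite -subr_eq0; apply/eqP; move: phi0.
  by have [x <-] := quot_proj_surj (p - q); rewrite phiE => /quot_proj_eq0/CE/quot_proj_eq0.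
- by move=> q; have [x <-] := quot_proj_surj q; exists (quot_proj J x); rewrite psiE mulr1.
- move=> q; have [x <-] := quot_proj_surj q; rewrite psiE mulr1 quot_proj_eq0 J'E.
  split=> -[y]; first by move=> /quot_proj_eq xy; exists (quot_proj C y); rewrite phiE.
  have [z <-] := quot_proj_surj y; rewrite phiE => /esym /quot_proj_eq Jxz.
  by exists z.
Qed.

Lemma pdim_le_quot0 J n : (forall x, ideal_set J x -> x = 0) -> pdim_le (quot_mod J) n.
Proof.
move=> J0.
have qlin : linear (quot_proj J : S^o -> quot_mod J).
  by move=> c x y; rewrite quot_projZ -quot_projD.
pose q : {linear S^o -> quot_mod J} := HB.pack (quot_proj J : S^o -> quot_mod J)
  (GRing.isLinear.Build S S^o (quot_mod J) _ _ qlin).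
pose P i : lmodType S := if i is _.+1 then 'rV[S]_0 else S^o.
have P0 i (x : P i.+1) : x = 0 by apply: thinmx0.
exists P, (fun i => \0), q; split.
- case=> [|i]; first exact: projective_regular.
  exact/projective_trivial/P0.
- exact: quot_proj_surj.
- move=> x; split=> [/quot_proj_eq0/J0 ->|[y <-]]; first by exists 0.
  exact: linear0.
- by move=> i x; split=> [_|//]; exists 0; rewrite (P0 _ x).
- by case=> [|i] // _ x; apply: P0.
Qed.

Lemma pdim_le_mono (M : lmodType S) d n : (d <= n)%N -> pdim_le M d -> pdim_le M n.
Proof.
move=> ledn [P [bd [aug [projP augs exP0 exP Pbound]]]].
by exists P, bd, aug; split=> // i lt_ni; apply: Pbound; apply: leq_ltn_trans lt_ni.
Qed.

End CyclicModules.

(** * Monomial ideals as sets of exponents *)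

Section MonomialIdeals.
Variables (k : fieldType) (r : nat).
Implicit Types (A : 'X_{1..r} -> Prop) (m q : 'X_{1..r}) (x y : {mpoly k[r]}).

Definition upward_closed A : Prop := forall m q, (m <= q)%MM -> A m -> A q.

Definition mono_span A : set {mpoly k[r]} :=
  [set x | forall m, m \in msupp x -> exists2 q, A q & (q <= m)%MM].

Fact mono_span_ideal A : is_ideal (mono_span A).
Proof.
split=> [m|x y Ax Ay m|x y Ay m]; first by rewrite msupp0.
  by move=> /msuppD_le; rewrite mem_cat => /orP[/Ax|/Ay].
move=> /msuppM_le /allpairsP[[m1 m2] /= [_ /Ay[q Aq qm2] ->]].
by exists q => //; apply: lepm_trans qm2 (lem_addl _ _).
Qed.

Definition mono_ideal A : ideal {mpoly k[r]} := Ideal (mono_span_ideal A).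

Lemma mono_idealP A x : upward_closed A ->
  ideal_set (mono_ideal A) x <-> (forall m, m \in msupp x -> A m).
Proof.
move=> upA; split=> [Ax m /Ax[q Aq qm]|Ax m /Ax Am]; first exact: upA Aq.
by exists m => //; apply: lepm_refl.
Qed.

Lemma mono_idealX A m : upward_closed A -> ideal_set (mono_ideal A) 'X_[m] <-> A m.
Proof.
move=> upA; rewrite mono_idealP //; split=> [|Am q]; first by apply; rewrite msuppX inE.
by rewrite msuppX inE => /eqP->.
Qed.

Lemma ideal_sum (S : comNzRingType) (J : ideal S) (T : eqType) (s : seq T) (F : T -> S) :
  (forall i, i \in s -> ideal_set J (F i)) -> ideal_set J (\sum_(i <- s) F i).
Proof.
case: (ideal_axiom J) => J0 JD _ JF; rewrite big_seq.
by elim/big_ind: _.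
Qed.

Lemma ideal_support (J : ideal {mpoly k[r]}) x :
  (forall m, m \in msupp x -> ideal_set J 'X_[m]) -> ideal_set J x.
Proof.
move=> Jm; rewrite (mpolyE x); apply: ideal_sum => m /Jm JXm.
by case: (ideal_axiom J) => _ _ JM; rewrite -mul_mpolyC; apply: JM.
Qed.

Lemma mono_ideal_monomial A : monomial_ideal (mono_ideal A).
Proof.
exists A; apply/seteqP; split=> [x Ax J [JI JA]|x]; last first.
  apply; split; first exact: mono_span_ideal.
  move=> _ [m Am <-] q; rewrite msuppX inE => /eqP->.
  by exists m => //; apply: lepm_refl.
apply: (@ideal_support (Ideal JI)) => m /Ax[q Aq qm].
have [_ _ JM] := JI; rewrite -(submK qm) mpolyXD; apply: JM.
by apply: JA; exists q.
Qed.

Definition exponents (J : set {mpoly k[r]}) : 'X_{1..r} -> Prop := fun m => J 'X_[m].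

Lemma exponents_up (J : ideal {mpoly k[r]}) : upward_closed (exponents J).
Proof.
move=> m q mq Jm; rewrite /exponents -(submK mq) mpolyXD.
by case: (ideal_axiom J) => _ _; apply.
Qed.

Lemma monomial_idealE (J : ideal {mpoly k[r]}) :
  monomial_ideal J -> J = mono_ideal (exponents J).
Proof.
move=> [M JE]; apply: ideal_eq => x; split=> [|Jx]; last first.
  by apply: ideal_support => m /Jx[q Jq qm]; apply: exponents_up Jq.
rewrite JE; apply; split; first exact: mono_span_ideal.
move=> _ [m Mm <-] q; rewrite msuppX inE => /eqP->; exists m; last exact: lepm_refl.
by move=> K [_]; apply; exists m.
Qed.

Definition pdim_mono n A : Prop := pdim_le (quot_mod (mono_ideal A)) n.

Lemma pdim_mono0 n : pdim_mono n (fun=> False).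
Proof.
apply: pdim_le_quot0 => x x0; rewrite [x]mpolyE big_seq big1 // => m /x0[].
by [].
Qed.

(** The colon ideal by the monomial of [m] is spanned by the [q] with [m + q] in [A], so
    [pdim_le_quot_add] applies. *)
Lemma pdim_mono_add A m d n : upward_closed A -> (d < n)%N ->
    pdim_mono d (fun q => A (m + q)%MM) -> pdim_mono n A ->
  pdim_mono n (fun q => A q \/ (m <= q)%MM).
Proof.
move=> upA ltdn; apply: (@pdim_le_quot_add _ _ _ _ 'X_[m]) => // [x|y].
  have upC : upward_closed (fun q => A (m + q)%MM).
    by move=> q q' qq'; apply: upA; apply/mnm_lepP => i; rewrite !mnmDE leq_add2l; move/mnm_lepP: qq'.
  rewrite (mono_idealP _ upC) (mono_idealP _ upA); split=> Ax q.
    by rewrite (perm_mem (msuppMX _ _)) => /mapP[q' /Ax Aq' ->].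
  by move=> qx; apply: Ax; rewrite (perm_mem (msuppMX _ _)); apply: map_f.
have upA' : upward_closed (fun q => A q \/ (m <= q)%MM).
  move=> q q' qq' [/(upA _ _ qq')|]; first by left.
  by move=> mq; right; apply: lepm_trans mq qq'.
rewrite (mono_idealP _ upA'); split=> [A'y|[x]].
  (* The cofactor collects the terms of [y] divisible by the monomial of [m]; all other terms have
     exponents in [A]. *)
  exists (\sum_(q <- msupp y | (m <= q)%MM) y@_q *: 'X_[q - m]).
  rewrite {1}[y]mpolyE (bigID (fun q => (m <= q)%MM)) /= big_distrl /= addrAC -sumrB.
  rewrite big1 ?add0r => [|q mq]; last by rewrite -scalerAl -mpolyXD submK // subrr.
  rewrite -big_filter; apply: (ideal_sum (J := mono_ideal A)) => q; rewrite mem_filter => /andP[mq /A'y].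
  case=> [Aq|]; last by rewrite (negPf mq).
  by case: (mono_span_ideal A) => _ _ AM; rewrite -mul_mpolyC; apply/AM/mono_idealX.
rewrite (mono_idealP _ upA) => Ayx q qy.
have : q \in msupp (y - x * 'X_[m] + x * 'X_[m]) by rewrite subrK.
move=> /msuppD_le; rewrite mem_cat => /orP[/Ayx|]; first by left.
by rewrite (perm_mem (msuppMX _ _)) => /mapP[q' _ ->]; right; apply: lem_addr.
Qed.

Lemma eq_pdim_mono n A A' : (forall m, A m <-> A' m) -> pdim_mono n A -> pdim_mono n A'.
Proof. by move=> AA'; have -> : A = A' by apply/funext => m; apply/propext. Qed.

(** The Koszul bound, one variable at a time: a new variable is a nonzerodivisor modulo the ideal of
    the previous ones, so that ideal is its own colon ideal and each variable costs one. *)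
Lemma pdim_mono_vars (Y : {set 'I_r}) :
  pdim_mono #|Y| (fun q => exists2 i, i \in Y & (0 < q i)%N).
Proof.
move: {2}#|Y| (erefl #|Y|) => d; elim: d => [|d IHd] in Y * => cardY.
  apply: eq_pdim_mono (pdim_mono0 _) => m; split=> // -[i].
  by rewrite (cards0_eq cardY) inE.
have [Y0|[i iY]] := set_0Vmem Y; first by rewrite Y0 cards0 in cardY.
have cardYi : #|Y :\ i| = d by move: cardY; rewrite (cardsD1 i Y) iY => -[].
have {IHd} := IHd _ cardYi; rewrite cardYi cardY => IHd.
have upA : upward_closed (fun q => exists2 j, j \in Y :\ i & (0 < q j)%N).
  move=> q q' /mnm_lepP qq' [j jY qj]; exists j => //; exact: leq_trans (qq' j).
apply: (eq_pdim_mono _ (@pdim_mono_add _ U_(i)%MM d d.+1 upA _ _ _)) => //.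
- move=> q; split=> [[[j]|]|[j jY qj]].
  + by rewrite !inE => /andP[_ jY] qj; exists j.
  + by rewrite lep1mP -lt0n => qi; exists i.
  have [<-|nij] := eqVneq j i; first by right; rewrite lep1mP -lt0n.
  by left; exists j => //; rewrite !inE nij.
- apply: eq_pdim_mono IHd => q; split=> -[j jY qj]; exists j => //.
    by rewrite mnmDE ltn_addl.
  by move: jY qj; rewrite mnmDE mnm1E !inE eq_sym => /andP[/negPf->].
- exact: pdim_le_mono IHd.
Qed.

End MonomialIdeals.

(** The nonemptiness assumption stands below the quantifier on [e], so that [choice] applies to
    families in which some predicates are empty. *)
Lemma least_nat (P : nat -> Prop) :
  exists e, (exists i, P i) -> P e /\ forall i, P i -> (e <= i)%N.
Proof.
have [exP|noP] := pselect (exists i, P i); last by exists 0%N.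
have exb : exists i, `[<P i>] by case: exP => i Pi; exists i; apply/asboolP.
exists (ex_minn exb) => _; case: ex_minnP => e /asboolP Pe mine.
by split=> // i Pi; apply/mine/asboolP.
Qed.

(** * Adding sets of monomials without exceeding a projective dimension *)

Section Addable.
Variables (k : fieldType) (r n : nat).
Implicit Types (A L : 'X_{1..r} -> Prop) (m q : 'X_{1..r}).

(* Relative linear quotients: [L] need not be closed upwards itself, only
   [A] and [A \/ L] are. *)
Definition addable L : Prop := forall A, upward_closed A ->
  (forall m, A m -> ~ L m) -> upward_closed (fun m => A m \/ L m) ->
  pdim_mono k n A -> pdim_mono k n (fun m => A m \/ L m).

Lemma eq_addable L L' : (forall m, L m <-> L' m) -> addable L -> addable L'.
Proof. by move=> LL'; have -> : L = L' by apply/funext => m; apply/propext. Qed.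

(** The fibres of [f] are added by increasing value. Since [f] never increases when going up inside
    [L], [A] together with the levels below [v] stays closed upwards. *)
Lemma addable_levels L (f : 'X_{1..r} -> nat) N :
    (forall m q, L m -> L q -> (m <= q)%MM -> (f q <= f m)%N) ->
    (forall m, L m -> (f m < N)%N) ->
    (forall m0, L m0 -> addable (fun m => L m /\ f m = f m0)) ->
  addable L.
Proof.
move=> f_anti f_bound addf A upA AL upAL pdA.
have upAf v : upward_closed (fun m => A m \/ L m /\ (f m < v)%N).
  move=> m q mq [Am|[Lm fm]]; first by left; apply: upA Am.
  have [|Aq|Lq] := upAL m q mq; [by right|by left|right; split=> //].
  exact: leq_ltn_trans (f_anti _ _ Lm Lq mq) fm.
suff pdf v : pdim_mono k n (fun m => A m \/ L m /\ (f m < v)%N).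
  apply: eq_pdim_mono (pdf N) => m; split=> -[Am|]; [by left|by case; right|by left|].
  by move=> Lm; right; split=> //; apply: f_bound.
elim: v => [|v IHv].
  by apply: eq_pdim_mono pdA => m; split=> [|[|[]]]; [left| |].
have splitv m : (A m \/ L m /\ (f m < v)%N) \/ (L m /\ f m = v) <->
                A m \/ L m /\ (f m < v.+1)%N.
  split=> [[[Am|[Lm fm]]|[Lm <-]]|[Am|[Lm]]].
  - by left.
  - by right; split=> //; apply: ltnW.
  - by right.
  - by left; left.
  by rewrite ltnS leq_eqVlt => /orP[/eqP|] fm; [right|left; right].
have [[m0 [Lm0 fm0]]|nov] := pselect (exists m, L m /\ f m = v); last first.
  apply: eq_pdim_mono IHv => m; rewrite -splitv; split; first by left.
  by case=> // fv; case: nov; exists m.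
subst v; apply: (eq_pdim_mono splitv); apply: (addf _ Lm0) => //.
- move=> m [Am [/AL]|[_ fm] [_ fmE]] //.
  by rewrite fmE ltnn in fm.
- by move=> m q mq /splitv /(upAf _ _ _ mq) /splitv.
Qed.

Lemma addable_fibers (T : eqType) (s : seq T) (f : T -> 'X_{1..r} -> nat) N L :
    (forall t m q, (m <= q)%MM -> (f t q <= f t m)%N) ->
    (forall t m, (f t m < N)%N) ->
    (forall m0, L m0 -> addable (fun m => L m /\ {in s, forall t, f t m = f t m0})) ->
  addable L.
Proof.
move=> f_anti f_bound; elim: s L => [|t s IHs] L addf.
  have [[m0 Lm0]|noL] := pselect (exists m, L m).
    by apply: eq_addable (addf m0 Lm0) => m; split=> [[]|].
  move=> A _ _ _; apply: eq_pdim_mono => m; split; [by left|case=> // Lm].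
  by case: noL; exists m.
apply: (@addable_levels _ (f t) N) => // [m q _ _ /f_anti|m0 Lm0]; first exact.
apply: IHs => m1 [Lm1 fm1]; apply: eq_addable (addf m1 Lm1) => m; split.
  move=> [Lm fm]; split; last by move=> t' t's; rewrite fm // inE t's orbT.
  by split=> //; rewrite fm ?inE ?eqxx.
move=> [[Lm fm] fms]; split=> // t'; rewrite inE => /orP[/eqP->|/fms//].
by rewrite fm fm1.
Qed.

(** A single generator [m0] is added. Raising an exponent in [Y] leaves the orthant, hence falls
    into [A], while raising the others stays outside [A]; so the colon ideal is generated by the
    variables of [Y]. *)
Lemma addable_orthant (Y : {set 'I_r}) m0 : (#|Y| < n)%N ->
  addable (fun m => (m0 <= m)%MM /\ {in Y, forall i, m i = m0 i}).
Proof.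
move=> ltYn A upA AL upAL pdA.
have upm0 m : (m0 <= m)%MM -> A m \/ (m0 <= m)%MM /\ {in Y, forall i, m i = m0 i}.
  by move=> m0m; apply: upAL m0m _; right; split=> //; apply: lepm_refl.
have colonE m : (exists2 i, i \in Y & (0 < m i)%N) <-> A (m0 + m)%MM.
  split=> [[i iY mi]|Am].
    case: (upm0 (m0 + m)%MM (lem_addr _ _)) => // -[_ /(_ i iY)].
    by rewrite mnmDE => /eqP; rewrite -{2}[m0 i]addn0 eqn_add2l => /eqP mi0; rewrite mi0 in mi.
  apply: contrapT => noi; apply: AL Am _; split; first exact: lem_addr.
  move=> i iY; rewrite mnmDE; case: (posnP (m i)) => [->|mi]; first by rewrite addn0.
  by case: noi; exists i.
have := pdim_mono_add upA ltYn (eq_pdim_mono colonE (pdim_mono_vars k Y)) pdA.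
apply: eq_pdim_mono => m; split=> [[Am|/upm0//]|[Am|[]]]; [by left|by left|by right].
Qed.

End Addable.

(** * Monomials sorted by their sets of low rays *)

Section Threshold.
Variables (k : fieldType) (r n a : nat) (rho : 'I_r) (Delta : {set {set 'I_r}}).
Implicit Types (m q : 'X_{1..r}) (G Y s t : {set 'I_r}).
Local Notation addable := (addable k n).

Definition low m : {set 'I_r} := [set i | (i != rho) && (m i < a)%N].

(* Closed upwards, independent of the exponent of [rho], and blind to exponents
   above [a]. *)
Definition insensitive (W : 'X_{1..r} -> Prop) : Prop :=
  forall m q, W m -> (forall i, i != rho -> (minn (m i) a <= q i)%N) -> W q.

Lemma rho_low m : rho \in low m = false.
Proof. by rewrite inE eqxx. Qed.

Lemma low_anti m q : (m <= q)%MM -> low q \subset low m.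
Proof.
move=> /mnm_lepP mq; apply/fintype.subsetP => i; rewrite !inE => /andP[-> /=].
exact: leq_ltn_trans.
Qed.

(** Outside [Y], only the exponents at [o] and [rho] can be below [a], and [W] ignores the one at
    [rho]; hence [L] is an orthant whose corner takes the least exponent at [o]. *)
Lemma addable_box W e Y o m1 : insensitive W -> rho \notin Y -> (#|Y| < n)%N ->
  let L m := [/\ W m, (e <= m rho)%N, {in Y, forall i, m i = m1 i} &
     forall i, i \notin Y -> i != o -> i != rho -> (a <= m i)%N] in
  L m1 -> addable L.
Proof.
move=> Wins rhoY ltYn L Lm1.
have [t tP] := least_nat (fun v => exists2 m, L m & m o = v).
have [|[mt [Wt et mtY mt_hi] mto] tmin] := tP; first by exists (m1 o), m1.
(* The test for [o] precedes the one for [rho]: if [o = rho], the value [t] is used, and it is at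
   least [e] because it is attained in [L]. *)
pose m0 := [multinom if i \in Y then m1 i else if i == o then t
                     else if i == rho then e else a | i < r].
apply: eq_addable (addable_orthant (Y := Y) (m0 := m0) ltYn) => m; split.
  move=> [/mnm_lepP m0m mY].
  have mY1 : {in Y, forall i, m i = m1 i} by move=> i iY; rewrite mY // mnmE iY.
  split=> //.
  - apply: Wins Wt _ => i irho; have := m0m i; rewrite mnmE (negPf irho).
    case: ifP => [iY|_]; first by rewrite mtY // => /(leq_trans _)->//; apply: geq_minl.
    case: eqP => [->|_]; first by rewrite mto => /(leq_trans _)->//; apply: geq_minl.
    by move=> /(leq_trans _)->//; apply: geq_minr.
  - have := m0m rho; rewrite mnmE (negPf rhoY) eqxx; case: eqP => // orho.
    by apply: leq_trans; rewrite -mto -orho.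
  by move=> i iY io irho; have := m0m i; rewrite mnmE (negPf iY) (negPf io) (negPf irho).
move=> Lm; have [Wm em mY m_hi] := Lm; split; last first.
  by move=> i iY; rewrite mnmE iY mY.
apply/mnm_lepP => i; rewrite mnmE; case: ifPn => [iY|iY]; first by rewrite mY.
case: (eqVneq i o) => [->|io]; first by apply: tmin; exists m.
by case: (eqVneq i rho) => [->|irho] //; apply: m_hi.
Qed.

(** Quantifying over all subfamilies [T] makes a new free ridge available after each removal. *)
Definition free_ridges G : Prop := forall T : {set {set 'I_r}}, T != finset.set0 ->
  (forall s, s \in T -> [/\ s \in Delta, #|s| = n, G \subset s & rho \notin s]) ->
  exists2 s, s \in T & exists2 o, o \in s :\: G &
    forall s', s' \in T -> s :\ o \subset s' -> s' = s.

Hypothesis card_Delta : forall s, s \in Delta -> (#|s| <= n)%N.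

(** On [Y] the exponents are below [a], so the truncated difference [a - m i] determines [m i]; it
    is bounded and never increases upwards. *)
Lemma addable_low_values Y L :
    (forall m, L m -> Y \subset low m) ->
    (forall m1, L m1 -> addable (fun m => L m /\ {in Y, forall i, m i = m1 i})) ->
  addable L.
Proof.
move=> Ylow addL; apply: (@addable_fibers _ _ _ _ (enum Y) (fun i m => a - m i)%N a.+1).
- by move=> i m q /mnm_lepP mq; apply: leq_sub2l.
- by move=> i m; rewrite ltnS leq_subr.
move=> m1 Lm1; apply: eq_addable (addL m1 Lm1) => m; split=> -[Lm mE]; split=> // i.
  by rewrite mem_enum => /mE->.
move=> iY; have := mE i; rewrite mem_enum iY => /(_ isT).
have := fintype.subsetP (Ylow m Lm) i iY; have := fintype.subsetP (Ylow m1 Lm1) i iY.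
rewrite !inE => /andP[_ /ltnW m1a] /andP[_ /ltnW ma] eqa.
by rewrite -(subKn ma) eqa subKn.
Qed.

(** Once the exponents on [Y] are fixed, the bounds on [low m] say exactly that the exponents off
    [Y], [o] and [rho] are at least [a], which is the situation of [addable_box]. *)
Lemma addable_interval W e G Y o m0 :
    insensitive W -> G \subset Y -> rho \notin Y -> (#|Y| < n)%N ->
  addable (fun m => [/\ W m, (e <= m rho)%N, {in G, forall i, m i = m0 i},
                        Y \subset low m & low m \subset o |: Y]).
Proof.
move=> Wins /fintype.subsetP GY rhoY ltYn.
apply: (@addable_low_values Y) => [m []//|m1 [W1 e1 G1 /fintype.subsetP Y1 /fintype.subsetP o1]].
have hi m : low m \subset o |: Y -> forall i, i \notin Y -> i != o -> i != rho -> (a <= m i)%N.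
  move=> /fintype.subsetP mo i iY io irho; rewrite leqNgt; apply/negP => mi.
  by have := mo i; rewrite !inE irho mi (negPf iY) (negPf io) => /(_ isT).
apply: eq_addable (@addable_box W e Y o m1 Wins rhoY ltYn _); last first.
  by split=> //; apply: hi; apply/fintype.subsetP.
move=> m; split=> [[Wm em mY m_hi]|[[Wm em _ _ mo] mY]]; last by split=> //; apply: hi.
split=> //; split=> //.
- by move=> i iG; rewrite mY ?G1 ?GY.
- apply/fintype.subsetP => i iY; have := Y1 i iY.
  by rewrite !inE mY.
apply/fintype.subsetP => i; rewrite !inE => /andP[irho mi].
apply: contraLR mi; rewrite negb_or -leqNgt => /andP[io iY]; exact: m_hi.
Qed.

(** Induction on the number of [n]-ray cones in [K]. For a cone [s] with free ridge [t], the
    monomials whose low set is [s] or [t] form one interval and are added last; all the others come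
    from the induction. *)
Lemma addable_low W e G m0 (K : {set {set 'I_r}}) :
    insensitive W -> free_ridges G ->
    (forall s, s \in K -> [/\ s \in Delta, G \subset s & rho \notin s]) ->
    (forall s o, s \in K -> #|s| = n -> o \in s :\: G -> s :\ o \in K) ->
  addable (fun m => [/\ W m, (e <= m rho)%N, {in G, forall i, m i = m0 i} & low m \in K]).
Proof.
move=> Wins freeG.
have [c] := ubnP #|[set s in K | #|s| == n]|; elim: c => // c IHc in K *.
rewrite ltnS => cardT KP Kridge.
have [T0|Tn0] := eqVneq [set s in K | #|s| == n] finset.set0.
  apply: (@addable_fibers _ _ _ _ (enum 'I_r) (fun i m => i \in low m) 2).
  - by move=> i m q /low_anti/fintype.subsetP/(_ i); case: (i \in low q) => // ->.
  - by move=> i m; case: (i \in _).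
  move=> m1 [_ _ _]; set Y := low m1 => YK.
  have [YD GY rhoY] := KP Y YK.
  have ltYn : (#|Y| < n)%N.
    rewrite ltn_neqAle card_Delta // andbT; apply/negP => Yn.
    by move: T0 => /finset.setP/(_ Y); rewrite finset.in_set0 finset.inE YK Yn.
  (* With [o := rho] the interval shrinks to the single low set [Y], since [rho] is never low. *)
  apply: eq_addable (addable_interval (e := e) (m0 := m0) (o := rho) Wins GY rhoY ltYn) => m; split.
    move=> [Wm em mG Ym mY]; have mYE : low m = Y.
      apply/eqP; rewrite finset.eqEsubset Ym andbT; apply/fintype.subsetP => i im.
      by have := fintype.subsetP mY i im; rewrite finset.in_setU1; case/orP=> // /eqP irho;
        move: im; rewrite irho rho_low.
    by split=> [|i _ /=]; [split=> //; rewrite mYE | rewrite mYE].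
  move=> [[Wm em mG mK] mY]; have -> : low m = Y.
    by apply/finset.setP => i; have := mY i; rewrite mem_enum;
      do 2!case: (i \in _) => // /(_ isT).
  by split=> //; apply: finset.subsetUr.
have [|s] := freeG _ Tn0.
  by move=> s; rewrite !inE => /andP[/KP[sD Gs rhos] /eqP sn].
rewrite !inE => /andP[sK /eqP sn] [o /[dup] osG]; rewrite inE => /andP[oG os] s_only.
have [sD Gs rhos] := KP s sK.
set t := s :\ o in s_only.
have tK : t \in K by apply: Kridge.
have [tD Gt rhot] := KP t tK.
have cardt : #|t|.+1 = n by rewrite -sn (cardsD1 o s) os.
have ts : t \subset s by apply: finset.subD1set.
(* By freeness [s] is the only [n]-ray member of [K] above [t]; any smaller member above [t] has no
   more rays than [t], so it equals [t]. *)
have above m : low m \in K -> t \subset low m -> low m \in [set s; t]%SET.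
  move=> mK tm; rewrite !inE.
  have [mn|mn] := eqVneq #|low m| n.
    by rewrite (s_only (low m)) ?eqxx // !inE mK mn eqxx.
  rewrite orbC eq_sym finset.eqEcard tm -ltnS cardt ltn_neqAle mn card_Delta //.
  by case: (KP _ mK).
apply: (@addable_levels _ _ _ _ (fun m => low m \in [set s; t]%SET) 2).
- move=> m q [_ _ _ mK] [_ _ _ qK] /low_anti qm.
  case: (boolP (low q \in _)) => // qst; rewrite above //.
  by apply: fintype.subset_trans qm; move: qst; rewrite !inE => /orP[]/eqP->.
- by move=> m _; case: (_ \in _).
move=> m1 [_ _ _ m1K]; case: (boolP (low m1 \in _)) => [m1st|m1st].
  apply: eq_addable (addable_interval (e := e) (m0 := m0) (o := o) Wins Gt rhot _); last by rewrite cardt.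
  move=> m; rewrite /t finset.setD1K //; split.
    move=> [Wm em mG tm ms]; have : low m \in [set s; t]%SET.
      rewrite !inE; have [om|om] := boolP (o \in low m).
        rewrite finset.eqEsubset ms -(finset.setD1K os) finset.subUset tm andbT.
        by rewrite finset.sub1set om.
      rewrite orbC finset.eqEsubset tm andbT; apply/orP; left.
      by rewrite finset.subsetD1 ms om.
    move=> mst; rewrite mst; split=> //; split=> //.
    by move: mst; rewrite !inE => /orP[]/eqP->.
  move=> [[Wm em mG mK]]; case: (boolP (_ \in _)) => // mst _; split=> //.
    by move: mst; rewrite !inE => /orP[]/eqP->.
  by move: mst; rewrite !inE => /orP[]/eqP->.
apply: eq_addable (IHc (K :\: [set s; t]%SET) _ _ _).
- move=> m; split.
    by move=> [Wm em mG]; rewrite inE => /andP[/negPf-> mK].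
  by move=> [[Wm em mG mK]]; case: (boolP (_ \in _)) => // mst _; rewrite inE mst.
- apply: leq_trans cardT; rewrite [X in (_ < X)%N](cardsD1 s) !inE sK sn eqxx ltnS.
  apply/subset_leq_card/fintype.subsetP => s'; rewrite !inE negb_or -!andbA.
  by case/and4P=> -> _ -> ->.
- by move=> s'; rewrite inE => /andP[_ /KP].
(* The smaller family still contains the ridges of its [n]-ray cones: such a ridge is too small to
   be [s], and it is not [t] because [t] is free. *)
move=> s' o'; rewrite !finset.in_setD !finset.in_set2 !negb_or.
move=> /andP[/andP[s's _] s'K] s'n o's'.
rewrite Kridge // ?finset.in_setD // andbT; apply/andP; split.
  apply: contra_eqN s'n => /eqP s'E; have := cardsD1 o' s'.
  by move: o's' => /andP[_ ->]; rewrite s'E sn => ->; rewrite add1n gtn_eqF.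
apply: contra s's => /eqP s'E; apply/eqP/s_only; first by rewrite !inE s'K s'n eqxx.
by rewrite -s'E finset.subD1set.
Qed.

End Threshold.

(** * Ordering the monomials of the threshold ideal *)

Section ThresholdIdeal.
Variables (k : fieldType) (r n a : nat) (rho : 'I_r) (Delta : {set {set 'I_r}}).
Implicit Types (m q : 'X_{1..r}) (G Y s t : {set 'I_r}).
Variable U : 'X_{1..r} -> Prop.

Hypothesis Delta_down : forall s t, s \in Delta -> t \subset s -> t \in Delta.
Hypothesis card_Delta : forall s, s \in Delta -> (#|s| <= n)%N.
Hypothesis rho_Delta : [set rho]%SET \in Delta.
Hypothesis Delta_free : forall G, rho \notin G -> rho |: G \in Delta ->
  free_ridges n rho Delta G.
Hypothesis U_trunc : forall m q, U m -> (forall i, (minn (m i) a <= q i)%N) -> U q.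
(** Saturation read on exponents: a monomial outside the ideal stays outside when the variables off
    some cone get the large exponent [a]. *)
Hypothesis U_sat : forall m, ~ U m -> exists2 s, s \in Delta &
  ~ U [multinom if i \in s then m i else a | i < r].

Definition with_exponent m e : 'X_{1..r} := [multinom if i == rho then e else m i | i < r].

(* The exponents of [m] on [G] are the reason why [m] leaves [U] when its
   [rho]-exponent is lowered to [e]; the value [a] stands for infinity. *)
Definition blocking e m G : Prop :=
  {in G, forall i, (m i < a)%N} /\
  ~ U [multinom if i == rho then e else if i \in G then m i else a | i < r].

Lemma U_up m q : U m -> (forall i, (m i <= q i)%N) -> U q.
Proof. by move=> /U_trunc UP mq; apply: UP => i; rewrite geq_min mq. Qed.

Lemma with_exponent_insensitive e : insensitive a rho (fun m => U (with_exponent m e)).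
Proof.
move=> m q /U_trunc UP mq; apply: UP => i; rewrite !mnmE.
by case: eqP => [_|/eqP/mq//]; apply: geq_minl.
Qed.

(** If [G] blocks [q], the exponents of [q] on [G] are below [a], so truncation loses nothing there
    and [m] lies below [q] on [G]; hence [G] blocks [m] too. *)
Lemma blocking_insensitive e G : rho \notin G ->
  insensitive a rho (fun m => ~ blocking e m G).
Proof.
move=> rhoG m q mNb mq; apply: contra_not mNb => -[qG NU].
have mqG i : i \in G -> (m i <= q i)%N.
  move=> iG; have irho : i != rho by apply: contraNneq rhoG => <-.
  have := mq i irho; have := qG i iG; rewrite geq_min => qa /orP[//|aq].
  by move: qa; rewrite ltnNge aq.
split=> [i iG|]; first by apply: leq_ltn_trans (mqG i iG) (qG i iG).
apply: contra_not NU => /U_up; apply => i; rewrite !mnmE.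
by case: ifP => // _; case: ifP => // /mqG.
Qed.

Lemma exists_blocking m e : U m -> ~ U (with_exponent m e) ->
  exists G, [/\ rho \notin G, rho |: G \in Delta & blocking e m G].
Proof.
move=> Um /U_sat[s sD NU].
have rhos : rho \in s.
  apply: contra_notT NU => rhos; apply: U_trunc Um _ => i; rewrite !mnmE.
  case: ifP => [|_]; last by rewrite geq_minr.
  by case: eqP => [->|_ _]; [rewrite (negPf rhos) | apply: geq_minl].
exists (s :&: low a rho m); split.
- by rewrite inE rho_low andbF.
- by apply: Delta_down sD _; rewrite finset.subUset finset.sub1set rhos finset.subsetIl.
split=> [i|]; first by rewrite !inE => /and3P[].
apply: contra_not NU => /U_trunc; apply => i; rewrite !mnmE !inE.
case: ifP => [/eqP->|/negbT irho] /=; first by rewrite rhos geq_minl.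
rewrite irho /=; case: (i \in s) => /=; last exact: geq_minr.
by rewrite ltnNge; case: (leqP a (m i)) => [am|_] /=; [rewrite minnn | apply: geq_minl].
Qed.

Lemma pdim_threshold :
  pdim_mono k n (fun m => U m /\ low a rho m \in Delta).
Proof.
suff addL : addable k n (fun m => U m /\ low a rho m \in Delta).
  apply: eq_pdim_mono (addL (fun=> False) _ _ _ (pdim_mono0 _ _ _)) => [m|//|//|].
    by split=> [[]|] //; right.
  move=> m q mq [//|[Um mD]]; right; split.
    by apply: U_up Um _; apply/mnm_lepP.
  exact: Delta_down mD (low_anti _ _ mq).
have [ex exP] : exists ex : 'X_{1..r} -> nat, forall m, U m ->
    U (with_exponent m (ex m)) /\ forall e, U (with_exponent m e) -> (ex m <= e)%N.
  have /choice[ex exP] m := least_nat (fun e => U (with_exponent m e)).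
  exists ex => m Um; apply: exP; exists (m rho).
  by apply: U_up Um _ => i; rewrite mnmE; case: eqP => [->|].
apply: (@addable_levels _ _ _ _ ex a.+1).
- move=> m q [Um _] [Uq _] /mnm_lepP mq; have [Um' _] := exP m Um.
  have [_] := exP q Uq; apply; apply: U_up Um' _ => i; rewrite !mnmE.
  by case: eqP.
- move=> m [Um _]; rewrite ltnS; have [_] := exP m Um; apply.
  apply: U_trunc Um _ => i; rewrite mnmE; case: eqP => _; [exact: geq_minr|exact: geq_minl].
move=> m1 [Um1 _]; have [Ue1 min1] := exP m1 Um1.
set e := ex m1 in Ue1 min1 *.
have fiberE m : ((U m /\ low a rho m \in Delta) /\ ex m = e) <->
    [/\ U (with_exponent m e), (e <= m rho)%N, low a rho m \in Delta &
        forall e', U (with_exponent m e') -> (e <= e')%N].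
  split=> [[[Um mD] <-]|[Ume em mD mine]].
    have [Ume mine] := exP m Um; split=> //; apply: mine.
    by apply: U_up Um _ => i; rewrite mnmE; case: eqP => [->|].
  have Um : U m by apply: U_up Ume _ => i; rewrite mnmE; case: eqP => [->|].
  have [Ume' mine'] := exP m Um.
  by split=> //; apply/eqP; rewrite eqn_leq mine' // mine.
apply: eq_addable (fun m => iff_sym (fiberE m)) _.
move: e Ue1 min1 {fiberE} => [|e] Ue1 min1.
  (* At level 0 there is no lower exponent to exclude, so the empty face serves as [G]. *)
  have free0 : free_ridges n rho Delta finset.set0.
    by apply: Delta_free; rewrite ?inE // finset.setU0.
  apply: eq_addable (addable_low (e := 0) (m0 := 0%MM) (G := finset.set0)
    (K := [set s in Delta | rho \notin s]) card_Delta (@with_exponent_insensitive 0%N) free0 _ _).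
  - move=> m; rewrite inE rho_low andbT; split=> [[]|[]] *; split=> //.
    by move=> i; rewrite inE.
  - by move=> s; rewrite inE finset.sub0set => /andP[].
  move=> s o; rewrite !inE => /andP[sD rhos] _ _.
  rewrite (negPf rhos) !andbF andbT; apply: Delta_down sD _; exact: finset.subD1set.
pose Gs := enum [set G : {set 'I_r} | (rho \notin G) && (rho |: G \in Delta)]%SET.
have GsP G : G \in Gs -> rho \notin G /\ rho |: G \in Delta.
  by rewrite mem_enum inE => /andP.
pose P m i := (i < size Gs)%N /\ blocking e m (nth finset.set0 Gs i).
have [ix ixP] : exists ix : 'X_{1..r} -> nat, forall m, (exists i, P m i) ->
    P m (ix m) /\ forall i, P m i -> (ix m <= i)%N.
  by have /choice[ix ixP] m := least_nat (P m); exists ix.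
pose L m := [/\ U (with_exponent m e.+1), (e < m rho)%N, low a rho m \in Delta &
  forall e', U (with_exponent m e') -> (e < e')%N].
have LP m : L m -> P m (ix m) /\ forall i, P m i -> (ix m <= i)%N.
  move=> [Um em mD mine]; apply: ixP.
  have [||G [rhoG GD Gb]] := @exists_blocking m e.
  - by apply: U_up Um _ => i; rewrite mnmE; case: eqP => [->|].
  - by move=> /mine; rewrite ltnn.
  exists (index G Gs); have GGs : G \in Gs by rewrite mem_enum inE rhoG.
  by split; rewrite ?index_mem ?nth_index.
(* Going up can only destroy blocking faces, so the index [ix] of the first one never decreases;
   subtracting it from [size Gs] reverses the order. *)
apply: (@addable_levels _ _ _ L (fun m => size Gs - ix m)%N (size Gs).+1).
- move=> m q Lm Lq mq; apply: leq_sub2l; have [_ minm] := LP m Lm; apply: minm.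
  have [[iq bq] _] := LP q Lq; split=> //; apply: contrapT => mNb.
  have [rhoG _] := GsP _ (mem_nth finset.set0 iq).
  apply: (blocking_insensitive rhoG mNb _ bq) => i _.
  by rewrite geq_min (mnm_lepP mq).
- by move=> m _; rewrite ltnS leq_subr.
move=> m2 L2; have [[j_lt Gb] minj] := LP m2 L2; set j := ix m2 in j_lt Gb minj *.
set G := nth finset.set0 Gs j in Gb.
have [rhoG GD] := GsP _ (mem_nth finset.set0 j_lt).
have Glow m : blocking e m G -> G \subset low a rho m.
  move=> [Ga _]; apply/fintype.subsetP => i iG; rewrite inE Ga // andbT.
  by apply: contraNneq rhoG => <-.
have fiberE m : (L m /\ (size Gs - ix m = size Gs - j)%N) <-> (L m /\ ix m = j).
  split=> -[Lm]; last by move->.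
  have [[/ltnW ixm _] _] := LP m Lm.
  by move=> /eqP; rewrite eqn_sub2lE ?(ltnW j_lt) // => /eqP->.
apply: eq_addable (fun m => iff_sym (fiberE m)) _.
have bG m : L m /\ ix m = j -> blocking e m G by move=> [/LP[[_ +] _] mj]; rewrite mj.
apply: (addable_low_values (a := a) (rho := rho) (Y := G)) => [m /bG /Glow//|m3 [L3 ix3]].
(* That [G] blocks depends only on the exponents along [G], which are now those of [m3]; [W]
   therefore only has to record that no earlier face blocks. *)
pose W m := U (with_exponent m e.+1) /\ forall i, (i < j)%N -> ~ P m i.
have Wins : insensitive a rho W.
  move=> m q [Um NP] mq; split; first exact: with_exponent_insensitive Um mq.
  move=> i ij [i_lt bq]; apply: (NP i ij); split=> //; apply: contrapT => mNb.
  have [rhoGi _] := GsP _ (mem_nth finset.set0 i_lt).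
  exact: (blocking_insensitive rhoGi mNb mq bq).
apply: eq_addable (addable_low (e := e.+1) (m0 := m3) (G := G)
    (K := [set s in Delta | (G \subset s) && (rho \notin s)]) card_Delta Wins
    (Delta_free rhoG GD) _ _).
- move=> m; rewrite inE rho_low andbT; split; last first.
    move=> [Lmj mG]; have [Lm ixm] := Lmj; have [Um em mD _] := Lm; split=> //; last first.
      by rewrite mD Glow //; apply: bG.
    split=> // i ij Pmi; have [_ minm] := LP m Lm.
    by have := minm i Pmi; rewrite ixm leqNgt ij.
  move=> [[Um NP] em mG /andP[mD Gm]].
  have bm : blocking e m G.
    have [G3 NU] := bG m3 (conj L3 ix3); split=> [i iG|]; first by rewrite mG ?G3.
    apply: contra_not NU; congr U; apply/mnmP => i; rewrite !mnmE.
    by do 2!case: ifP => //; move=> iG _; rewrite mG.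
  have Lm : L m.
    split=> // e' Ue'; rewrite ltnNge; apply/negP => e'e; have [_] := bm; apply.
    apply: U_trunc Ue' _ => i; rewrite !mnmE; case: eqP => _.
      by apply: leq_trans e'e; apply: geq_minl.
    by case: ifP => _; [apply: geq_minl|apply: geq_minr].
  split=> //; split=> //; have [Pm minm] := LP m Lm; apply/eqP.
  rewrite eqn_leq minm //= leqNgt; apply/negP => /NP; exact.
- by move=> s; rewrite inE => /and3P[].
move=> s o; rewrite inE => /and3P[sD Gs_ rhos] _ osG.
rewrite inE (Delta_down sD (finset.subD1set _ _)) /= !inE (negPf rhos) andbF andbT.
by rewrite finset.subsetD1 Gs_; move: osG; rewrite inE => /andP[].
Qed.

End ThresholdIdeal.

(** * Coordinates dual to a free family of rays *)

Section DualCoordinates.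
Variables (R : fieldType) (n r : nat) (u : 'I_r -> 'rV[R]_n).
Implicit Types s : {set 'I_r}.

Lemma free_card s : free [seq u i | i <- enum s] -> (#|s| <= n)%N.
Proof.
rewrite /free size_map -cardE => /eqP <-.
apply: leq_trans (dimvS (subvf _)) _.
by rewrite dimvf dim_matrix -[(1 * n)%R]/(1 * n)%N mul1n.
Qed.

Lemma free_dual s : free [seq u i | i <- enum s] ->
  exists lam : 'I_r -> {scalar 'rV[R]_n},
    {in s &, forall i j, lam j (u i) = (i == j)%:R}.
Proof.
move=> freeu; pose X := in_tuple [seq u i | i <- enum s].
suff /choice[lam lamE] : forall j, exists l : {scalar 'rV[R]_n},
    j \in s -> {in s, forall i, l (u i) = (i == j)%:R}.
  by exists lam => i j si sj; apply: lamE.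
move=> j; have [js|] := boolP (j \in s); last by exists \0.
have idx i : i \in s -> (index i (enum s) < size [seq u i | i <- enum s])%N.
  by move=> si; rewrite size_map index_mem mem_enum.
exists (coord X (Ordinal (idx j js))) => _ i si.
have uE : X`_(Ordinal (idx i si)) = u i.
  by rewrite /= (nth_map i) ?nth_index ?index_mem ?mem_enum.
have := @coord_free _ _ _ X (Ordinal (idx i si)) (Ordinal (idx j js)) freeu.
rewrite uE => luE; apply: etrans luE _.
suff -> : (Ordinal (idx i si) == Ordinal (idx j js)) = (i == j) by [].
apply/eqP/eqP => [[]|ij]; last by apply: val_inj; rewrite /= ij.
by move=> /(congr1 (nth i (enum s))); rewrite !nth_index ?mem_enum.
Qed.

Lemma dual_expansion s (lam : 'I_r -> {scalar 'rV[R]_n}) v :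
    free [seq u i | i <- enum s] -> #|s| = n ->
    {in s &, forall i j, lam j (u i) = (i == j)%:R} ->
  v = \sum_(i in s) lam i v *: u i.
Proof.
move=> freeu cards lamE; pose t := in_tuple (enum s); pose X := map_tuple u t.
have /coord_span vE : v \in <<X>>%VS.
  suff /eqP-> : (<<X>> == fullv)%VS by rewrite memvf.
  rewrite eqEdim subvf dimvf dim_matrix -[(1 * n)%R]/(1 * n)%N mul1n (eqP freeu).
  by rewrite size_map -cardE cards leqnn.
have [d dE] : exists d, v = \sum_(i in s) d i *: u i.
  exists (fun i => if insub (index i (enum s)) is Some j then coord X j v else 0).
  rewrite -big_enum big_tnth [LHS]vE; apply: eq_bigr => j _.
  have -> : index (tnth t j) (enum s) = j.
    by rewrite (tnth_nth (tnth t j)) index_uniq ?enum_uniq.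
  by rewrite valK -tnth_nth tnth_map.
rewrite {1}dE; apply: eq_bigr => i si; congr (_ *: _).
rewrite dE linear_sum (bigD1 i) //= linearZ /= lamE // eqxx mulr1.
rewrite big1 ?addr0 // => j /andP[sj ji].
by rewrite linearZ /= lamE // (negPf ji) mulr0.
Qed.

Lemma scalar_column (l : {scalar 'rV[R]_n}) : exists m : 'cV[R]_n, forall v,
  (v *m m) 0 0 = l v.
Proof.
exists (\col_j l (delta_mx 0 j)) => v; rewrite {2}[v]row_sum_delta linear_sum mxE.
by apply: eq_bigr => j _; rewrite linearZ mxE.
Qed.

End DualCoordinates.

(** * Small perturbations and generic points *)

Section GenericPoint.
Variables (R : realFieldType) (V : lmodType R).

Lemma small_perturbation (T : eqType) (s : seq T) (a b : T -> R) :
  {in s, forall i, 0 < a i} -> exists2 e, 0 < e & {in s, forall i, 0 <= a i + e * b i}.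
Proof.
elim: s => [|i s IHs] a_gt0; first by exists 1.
have [|e e_gt0 eP] := IHs; first by move=> j js; apply: a_gt0; rewrite inE js orbT.
have ai : 0 < a i by apply: a_gt0; rewrite inE eqxx.
(* The summand 1 keeps the denominator positive when [b i = 0]. *)
pose d := a i / (1 + `|b i|).
have d_gt0 : 0 < d by rewrite divr_gt0 // ltr_wpDr.
have shrink (x y e1 e' : R) : 0 < e' -> e' <= e1 -> 0 < x -> 0 <= x + e1 * y -> 0 <= x + e' * y.
  move=> e'_gt0 e'e x_gt0 xy; have [y_ge0|/ltW y_le0] := lerP 0 y.
    by rewrite addr_ge0 ?mulr_ge0 // ltW.
  by apply: le_trans xy _; rewrite lerD2l ler_wnM2r.
exists (Num.min e d); first by rewrite lt_min e_gt0.
move=> j; rewrite inE => /predU1P[->|js]; last first.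
  apply: shrink (eP j js); rewrite ?lt_min ?e_gt0 ?ge_min ?lexx //.
  by apply: a_gt0; rewrite inE js orbT.
apply: (shrink _ _ d); rewrite ?lt_min ?e_gt0 ?d_gt0 ?ge_min ?lexx ?orbT //.
have dE : d * (1 + `|b i|) = a i by rewrite divfK // gt_eqF // ltr_wpDr.
rewrite -dE -mulrDr mulr_ge0 ?(ltW d_gt0) // -addrA addr_ge0 // -lerBlDr sub0r.
by rewrite -normrN ler_norm.
Qed.

Lemma generic_positive (r : nat) (T : finType) (u : 'I_r -> V) (s : {set 'I_r})
    (P : pred T) (f : T -> {scalar V}) :
    (forall t, P t -> exists2 i, i \in s & f t (u i) != 0) ->
  exists2 c : 'I_r -> R, forall i, 0 < c i &
    forall t, P t -> f t (\sum_(i in s) c i *: u i) != 0.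
Proof.
move=> f_neq0.
(* A point of the moment curve avoids all the hyperplanes [f t = 0]. *)
pose p t : {poly R} := \sum_(i in s) f t (u i) *: 'X^i.
have p_neq0 t : P t -> p t != 0.
  move=> /f_neq0[i si]; apply: contra_neq => pt0.
  have := congr1 (fun q : {poly R} => q`_i) pt0.
  rewrite coef0 coef_sum (bigD1 i) //= coefZ coefXn eqxx mulr1 big1 ?addr0 // => j /andP[_ ji].
  by rewrite coefZ coefXn eq_sym (inj_eq val_inj) (negPf ji) mulr0.
pose Q := \prod_(t | P t) p t.
have Q_neq0 : Q != 0 by apply/prodf_neq0.
have [x x_gt0 Qx] : exists2 x : R, 0 < x & ~~ root Q x.
  pose xs : seq R := [seq i.+1%:R | i <- iota 0 (size Q)].
  have uxs : uniq xs.
    by rewrite map_inj_uniq ?iota_uniq // => i j /eqP; rewrite eqr_nat => /eqP[].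
  have [/(max_poly_roots Q_neq0)/(_ uxs)|/allPn[_ /mapP[i _ ->] Qi]] := boolP (all (root Q) xs).
    by rewrite size_map size_iota ltnn.
  by exists i.+1%:R => //; rewrite ltr0n.
exists (fun i => x ^+ i) => [i|t Pt]; first exact: exprn_gt0.
have : (p t).[x] != 0.
  by apply: contraNneq Qx => ptx; rewrite rootE horner_prod (bigD1 t) //= ptx mul0r.
rewrite horner_sum linear_sum; apply: contra_neq => f0; rewrite -[RHS]f0.
by apply: eq_bigr => i _; rewrite linearZ hornerZ hornerXn mulrC.
Qed.

Lemma scalar_comb (c d : R) (f g : {scalar V}) :
  exists l : {scalar V}, forall v, l v = c * f v - d * g v.
Proof.
pose h v := c * f v - d * g v.
have h_lin : scalar h by move=> e v w; rewrite /h !linearP /=; ring.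
by exists (HB.pack_for {scalar V} h (GRing.isLinear.Build R V R _ h h_lin)).
Qed.

End GenericPoint.

(** * Free ridges in a simplicial fan *)

Section SimplicialFan.
Variables (R : realType) (n r : nat) (F : fan R n r).
Hypothesis simplicialF : simplicial_fan F.
Implicit Types (s t G : {set 'I_r}) (i o rho : 'I_r).
Local Notation u := (real_ray R (fan_ray F)).
Local Notation Delta := (fan_cones F).

Lemma simplicial_card s : s \in Delta -> (#|s| <= n)%N.
Proof. by move=> /simplicialF /free_card. Qed.

(** The sum of the dual coordinates of the rays in [s :\: t] is nonnegative on [s] and vanishes
    exactly on the rays of [t], so it cuts out [t] as a face. *)
Lemma simplicial_subset s t : s \in Delta -> t \subset s -> t \in Delta.
Proof.
move=> sD /fintype.subsetP ts; have [lam lamE] := free_dual (simplicialF sD).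
have /choice[col colE] j := scalar_column (lam j).
pose m := \sum_(j in s :\: t) col j.
have muE i : i \in s -> pairing (u i) m = (i \notin t)%:R.
  move=> si; rewrite /pairing mulmx_sumr summxE (eq_bigr _ (fun j _ => colE j _)).
  have [ti|ti] := boolP (i \in t).
    rewrite big1 // => j; rewrite inE => /andP[tj sj].
    by rewrite lamE //; case: eqP => // ij; rewrite -ij ti in tj.
  rewrite (bigD1 i) ?inE ?ti //= lamE // eqxx big1 ?addr0 // => j.
  by rewrite inE => /andP[/andP[_ sj] ji]; rewrite lamE // eq_sym (negPf ji).
apply: (fan_face sD); exists m => [i /muE->|i]; first exact: ler0n.
have [si|nsi] := boolP (i \in s); last first.
  by apply/negbTE; apply: contra nsi => /ts.
by rewrite muE // pnatr_eq0 eqb0 negbK.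
Qed.

(* Otherwise [u rho] plus a combination of the rays of [G] would lie in both cones,
   hence in the cone of their common face, which is contained in [G]. *)
Lemma exists_negative_coordinate s G rho (lam : 'I_r -> {scalar 'rV[R]_n}) :
    s \in Delta -> #|s| = n -> {in s &, forall i j, lam j (u i) = (i == j)%:R} ->
    G \subset s -> rho \notin s -> rho |: G \in Delta ->
  exists2 o, o \in s :\: G & lam o (u rho) < 0.
Proof.
move=> sD sn lamE /fintype.subsetP Gs rhos GD.
have rhoG : rho \notin G by apply: contra rhos => /Gs.
apply: contrapT => nex; pose c i := `|lam i (u rho)|.
pose v := u rho + \sum_(i in G) c i *: u i.
have vs : cone R (fan_ray F) s v.
  exists (fun i => if i \in s then lam i (u rho) + (if i \in G then c i else 0) else 0).
    move=> i; case: ifP => // si; case: ifP => Gi.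
      by rewrite -lerBlDl sub0r /c -normrN ler_norm.
    rewrite addr0 leNgt; apply/negP => lt0; apply: nex; exists i => //.
    by rewrite inE Gi si.
  rewrite /v {1}(dual_expansion (u rho) (simplicialF sD) sn lamE).
  rewrite [X in _ + X](_ : _ = \sum_(i in s) (if i \in G then c i else 0) *: u i).
    by rewrite -big_split; apply: eq_bigr => i si; rewrite si scalerDl.
  rewrite [RHS](bigID (mem G)) /= [X in _ + X]big1 ?addr0.
    apply: eq_big => [i|i ->//]; rewrite andb_idl //; exact: Gs.
  by move=> i /andP[_ /negPf->]; rewrite scale0r.
have vG : cone R (fan_ray F) (rho |: G) v.
  exists (fun i => if i == rho then 1 else c i).
    by move=> i; case: ifP => _; rewrite ?ler01 ?normr_ge0.
  rewrite big_setU1 //= eqxx scale1r; congr (_ + _); apply: eq_bigr => i iG.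
  by case: eqP => // irho; rewrite -irho iG in rhoG.
have [w [[m1 _ ws] [m2 _ wG]] coneE] := fan_meet sD GD.
have : cone R (fan_ray F) w v by rewrite -coneE; split.
move=> [d _ vE]; have [mu muE] := free_dual (simplicialF GD).
have rhoU : rho \in rho |: G by rewrite !inE eqxx.
(* The coordinate [mu rho] is 1 on [v] by construction, but 0 on the cone of [w], whose rays lie in
   [s] and thus avoid [rho]. *)
have : mu rho v = 1.
  rewrite linearD muE // eqxx linear_sum big1 ?addr0 // => i iG.
  rewrite linearZ /= muE ?inE ?iG ?eqxx ?orbT //.
  by case: eqP => [irho|_]; [rewrite -irho iG in rhoG | rewrite mulr0].
rewrite vE linear_sum big1 => [/esym/eqP|i iw]; first by rewrite oner_eq0.
have iG : i \in rho |: G by move: iw; rewrite wG => /andP[].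
rewrite linearZ /= muE //; case: eqP => [irho|_]; last by rewrite mulr0.
by move: iw; rewrite ws irho (negPf rhos).
Qed.

Lemma fan_free_ridges G rho : rho \notin G -> rho |: G \in Delta ->
  free_ridges n rho Delta G.
Proof.
move=> rhoG GD T /set0Pn[s0 s0T] TP; apply: contrapT => nofree.
have adjacent s o : s \in T -> o \in s :\: G ->
    exists s', [/\ s' \in T, s :\ o \subset s' & s' <> s].
  move=> sT osG; apply: contrapT => nos'; apply: nofree; exists s => //; exists o => //.
  by move=> s' s'T sub; apply: contrapT => ne; apply: nos'; exists s'.
have /choice[C CE] s : exists lam : 'I_r -> {scalar 'rV[R]_n}, s \in T ->
    {in s &, forall i j, lam j (u i) = (i == j)%:R}.
  have [sT|] := boolP (s \in T); last by exists (fun=> \0).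
  by have [sD _ _ _] := TP s sT; have [lam] := free_dual (simplicialF sD); exists lam.
have expand s v : s \in T -> v = \sum_(i in s) C s i v *: u i.
  move=> sT; have [sD sn _ _] := TP s sT.
  by apply: dual_expansion; [exact: simplicialF|exact: sn|exact: CE].
pose q := u rho.
have negq s : s \in T -> exists2 o, o \in s :\: G & C s o q < 0.
  by move=> sT; have [sD sn Gs rhos] := TP s sT; apply: exists_negative_coordinate => //; apply: CE.
clearbody q.
(* When the coordinate of [q] at [o] is nonzero, [f (s, o, o')] vanishes at a point exactly if the
   path from it in direction [q] has zero [o']-coordinate when its [o]-coordinate vanishes; a
   generic start excludes this. *)
have /choice[f fE] (t : {set 'I_r} * 'I_r * 'I_r) : exists l : {scalar 'rV[R]_n}, forall v,
    l v = C t.1.1 t.2 q * C t.1.1 t.1.2 v - C t.1.1 t.1.2 q * C t.1.1 t.2 v.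
  exact: scalar_comb.
pose P (t : {set 'I_r} * 'I_r * 'I_r) := [&& t.1.1 \in T, t.1.2 \in t.1.1, t.2 \in t.1.1,
  t.1.2 != t.2 & C t.1.1 t.1.2 q != 0].
have [|c c_gt0 cP] := @generic_positive R _ r _ u s0 P f.
  move=> [[s o] o'] /and5P[/= sT so so' oo' qo]; apply: contrapT => allz.
  have : f (s, o, o') (u o') = 0.
    rewrite [u o'](expand s0) // linear_sum big1 // => i si.
    rewrite linearZ /=; have [->|fi] := eqVneq (f (s, o, o') (u i)) 0; first exact: mulr0.
    by case: allz; exists i.
  rewrite fE /= !CE // eqxx eq_sym (negPf oo') mulr0 mulr1 sub0r => /eqP.
  by rewrite oppr_eq0 (negPf qo).
(* Move along [p + t *: q], [t >= 0]; modulo the span of [G], a pair [(s, o)] with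
   [exit (s, o)] means that this path leaves the cone of [s] at time [ratio s o],
   through the facet opposite to [o].  Beyond the last exit time the path is still
   in the neighbouring cone. *)
set p := \sum_(i in s0) c i *: u i in cP.
pose ratio s o := - C s o p / C s o q.
pose exit (x : {set 'I_r} * 'I_r) := [&& x.1 \in T, x.2 \in x.1 :\: G, C x.1 x.2 q < 0 &
  [forall o' in x.1 :\: G, 0 <= C x.1 o' p + ratio x.1 x.2 * C x.1 o' q]].
have exitP s (t : R) : s \in T -> {in s :\: G, forall o, 0 <= C s o p + t * C s o q} ->
    exists2 o, exit (s, o) & t <= ratio s o.
  move=> sT t_in; have [o0 o0s o0q] := negq s sT.
  pose Q o := (o \in s :\: G) && (C s o q < 0).
  have [|o /andP[os oq] omin] := @arg_minP _ R _ o0 Q (ratio s).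
    by rewrite /Q o0s.
  have t_le : t <= ratio s o.
    by rewrite /ratio ler_ndivlMr // -subr_ge0 opprK addrC t_in.
  exists o => //; rewrite /exit /= sT os oq /=; apply/forall_inP => o' o's.
  have [q_ge0|q_lt0] := lerP 0 (C s o' q).
    apply: le_trans (t_in o' o's) _; rewrite lerD2l; exact: ler_wpM2r.
  have := omin o'; rewrite /Q o's q_lt0 => /(_ isT).
  by rewrite [in X in _ <= X]/ratio ler_ndivlMr // -subr_ge0 opprK addrC.
have [o0 e0 o0_ge0] : exists2 o, exit (s0, o) & 0 <= ratio s0 o.
  apply: exitP => // o; rewrite inE => /andP[_ os].
  rewrite mul0r addr0 linear_sum (bigD1 o) //= linearZ /= CE // eqxx mulr1 big1 ?addr0.
    exact: ltW.
  by move=> i /andP[si io]; rewrite linearZ /= CE // (negPf io) mulr0.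
have [[s o] /and4P[/= sT osG qo /forall_inP p_in] smax] :=
  @arg_maxP _ R _ (s0, o0) exit (fun x => ratio x.1 x.2) e0.
have h_ge0 : 0 <= ratio s o by apply: le_trans o0_ge0 (smax _ e0).
set h := ratio s o in p_in smax h_ge0.
have [sD sn Gs rhos] := TP s sT.
have os : o \in s by move: osG; rewrite inE => /andP[].
have ho : C s o p = - h * C s o q by rewrite mulNr /h /ratio divfK ?lt_eqF // opprK.
have p_in_gt0 i : i \in s :\: G -> i != o -> 0 < C s i p + h * C s i q.
  move=> isG io; rewrite lt0r p_in // andbT; apply/negP => /eqP hi.
  have si : i \in s by move: isG; rewrite inE => /andP[].
  have /(cP _)/negP : P (s, o, i) by rewrite /P /= sT os si eq_sym io lt_eqF.
  apply; rewrite fE /= ho (_ : C s i p = - h * C s i q); first by apply/eqP; ring.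
  by apply/eqP; rewrite -subr_eq0 mulNr opprK hi.
have [s' [s'T sub_s' s's]] := adjacent s o sT osG.
have [s'D s'n Gs' rhos'] := TP s' s'T.
have cardso : #|s :\ o|.+1 = n by rewrite -sn (cardsD1 o s) os.
have [o' o's' o'so] : exists2 o', o' \in s' & o' \notin s :\ o.
  apply/subsetPn; apply/negP => /subset_leq_card; by rewrite s'n -cardso ltnn.
have s'E : o' |: (s :\ o) = s'.
  apply/eqP; rewrite finset.eqEcard finset.subUset finset.sub1set o's' sub_s'.
  by rewrite cardsU1 o'so add1n cardso s'n leqnn.
have o's : o' \notin s.
  apply: contra_notN s's => o's; have oo' : o' = o.
    by apply/eqP; move: o'so; rewrite !inE o's andbT negbK.
  by rewrite -s'E oo' finset.setD1K.
have o'o : o' != o by apply: contraNneq o's => ->.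
(* For the face [s :\ o] the negative coordinate can only be the one at [o]: the rays [o] and [o']
   lie on opposite sides of the common ridge. *)
have neg_o : C s o (u o') < 0.
  have [|||i] := @exists_negative_coordinate s (s :\ o) o' (C s) sD sn (CE s sT).
  - exact: finset.subD1set.
  - by [].
  - by rewrite s'E.
  by rewrite !inE negb_and negbK => /andP[/orP[/eqP->//|/negPf->]].
(* Change of basis from [s] to [s']: only [u o] has to be re-expanded. *)
have change i v : i \in s' -> C s' i v = (i \in s)%:R * C s i v + C s o v * C s' i (u o).
  move=> s'i; rewrite {1}[v](expand s) // linear_sum (bigD1 o) //= linearZ /= addrC.
  congr (_ + _); have [si|nsi] := boolP (i \in s); last first.
    rewrite mul0r big1 // => j /andP[sj jo]; rewrite linearZ /= CE //.
      by case: eqP => [ji|_]; [rewrite -ji sj in nsi | rewrite mulr0].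
    by rewrite -s'E !inE jo sj orbT.
  have io : i != o.
    apply: contraTneq s'i => ->; rewrite -s'E !inE eqxx /= orbF eq_sym; exact: o'o.
  rewrite mul1r (bigD1 i) /= ?si ?io // linearZ /= CE // eqxx mulr1 big1 ?addr0 // => j.
  move=> /andP[/andP[sj jo] ji]; rewrite linearZ /= CE // ?(negPf ji) ?mulr0 //.
  by rewrite -s'E !inE jo sj orbT.
have kappa : C s o (u o') * C s' o' (u o) = 1.
  have := change o' (u o') o's'; rewrite CE // eqxx (negPf o's) mul0r add0r.
  by move=> <-.
have kappa_lt0 : C s' o' (u o) < 0.
  by rewrite -(nmulr_rgt0 _ neg_o) kappa ltr01.
(* At time [h] the [o]-coordinate is 0, so the coordinates on the shared rays agree for [s] and [s']
   and are positive off [G]; they stay nonnegative for a short time [e]. *)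
have [|e e_gt0 eP] := @small_perturbation R _
  (enum ((s :\ o) :\: G)) (fun i => C s i p + h * C s i q)
  (fun i => C s i q + C s o q * C s' i (u o)).
  move=> i; rewrite mem_enum !inE => /and3P[iG io si].
  by apply: p_in_gt0; rewrite ?inE ?iG.
have [i|o1 exit1 le_ratio] := @exitP s' (h + e) s'T.
  rewrite inE => /andP[iG s'i]; rewrite (change i p) // (change i q) // ho.
  have [->|io'] := eqVneq i o'.
    rewrite (negPf o's) !mul0r !add0r.
    have -> : - h * C s o q * C s' o' (u o) + (h + e) * (C s o q * C s' o' (u o)) =
      e * (C s o q * C s' o' (u o)) by ring.
    by rewrite mulr_ge0 ?(ltW e_gt0) // mulr_le0 // ltW.
  have iso : i \in s :\ o by move: s'i; rewrite -s'E finset.in_setU1 (negPf io').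
  have si : i \in s by move: iso; rewrite inE => /andP[].
  rewrite si !mul1r; have := eP i; rewrite mem_enum finset.in_setD iG iso => /(_ isT).
  congr (0 <= _); ring.
have := smax _ exit1; rewrite leNgt => /negP; apply.
by apply: lt_le_trans le_ratio; rewrite ltrDl.
Qed.

End SimplicialFan.

(** * A uniform truncation bound for upward closed sets of exponents *)

Section Truncation.
Variable r : nat.
Implicit Types (m q : 'X_{1..r}) (U : 'X_{1..r} -> Prop).

(** A form of Dickson's lemma, by induction on the coordinates. The projection of [U] forgetting [o]
    has a bound [b'], and its finitely many truncated points are reached with exponent at most [E]
    at [o]; below [E], only finitely many slices with bounds [b e] remain. *)
Lemma truncation_exists_in (s : seq 'I_r) U : uniq s ->
    (forall m q, U m -> {in s, forall i, (m i <= q i)%N} -> U q) ->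
  exists a, forall m q, U m -> {in s, forall i, (minn (m i) a <= q i)%N} -> U q.
Proof.
elim: s U => [|o s IHs] U /= => [_|/andP[os us]] upU.
  by exists 0%N => m q Um _; apply: upU Um _.
pose at_o m e : 'X_{1..r} := [multinom if i == o then e else m i | i < r].
have upUe e m q : U (at_o m e) -> {in s, forall i, (m i <= q i)%N} -> U (at_o q e).
  move=> Um mq; apply: upU Um _ => i; rewrite inE !mnmE.
  by case: eqP => //= _ /mq.
have /choice[b bP] e := IHs _ us (upUe e).
have [|b' b'P] := IHs (fun m => exists e, U (at_o m e)) us.
  by move=> m q [e Um] mq; exists e; apply: upUe Um mq.
pose of_box (x : {ffun 'I_r -> 'I_b'.+1}) : 'X_{1..r} := [multinom x i : nat | i < r].
have /choice[E0 E0P] x : exists e0, (exists e, U (at_o (of_box x) e)) -> U (at_o (of_box x) e0).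
  have [[e Ue]|] := pselect (exists e, U (at_o (of_box x) e)); first by exists e.
  by exists 0%N.
pose E := (\max_x E0 x)%N.
pose a := maxn (maxn b' E) (\max_(e < E) b e)%N.
exists a => m q Um mq.
have mq_s c : (c <= a)%N -> {in s, forall i, (minn (m i) c <= q i)%N}.
  move=> ca i si; apply: leq_trans (mq i _); last by rewrite inE si orbT.
  by rewrite leq_min geq_minl (leq_trans (geq_minr _ _) ca).
have mq_o : (minn (m o) a <= q o)%N by apply: mq; rewrite inE eqxx.
have Ea : (E <= a)%N by rewrite !leq_max leqnn orbT.
have Umo : U (at_o m (m o)).
  by apply: upU Um _ => i _; rewrite mnmE; case: eqP => [->|].
have [lt_moE|le_Emo] := ltnP (m o) E.
  have : U (at_o q (m o)).
    apply: (bP _ m q Umo); apply: mq_s; rewrite leq_max; apply/orP; right.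
    exact: (leq_bigmax (Ordinal lt_moE)).
  move=> /upU; apply => i _; rewrite mnmE; case: eqP => // ->.
  by move: mq_o; rewrite (minn_idPl (leq_trans (ltnW lt_moE) Ea)).
pose x : {ffun 'I_r -> 'I_b'.+1} := [ffun i => inord (minn (m i) b')].
have xE i : of_box x i = minn (m i) b'.
  by rewrite mnmE ffunE inordK // ltnS geq_minr.
have /E0P Ux : exists e, U (at_o (of_box x) e).
  by apply: (b'P m); [exists (m o) | move=> i _; rewrite xE].
apply: upU Ux _ => i; rewrite inE mnmE; case: eqP => [->|_] /= => [_|si].
  apply: leq_trans mq_o; rewrite leq_min; apply/andP.
  by split; [apply: leq_trans le_Emo | apply: leq_trans Ea]; apply: leq_bigmax.
by rewrite xE mq_s // !leq_max leqnn.
Qed.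

Lemma truncation_exists U : upward_closed U ->
  exists a, forall m q, U m -> (forall i, (minn (m i) a <= q i)%N) -> U q.
Proof.
move=> upU; have [m q Um mq|a aP] := truncation_exists_in (U := U) (enum_uniq 'I_r).
  by apply: upU Um; apply/mnm_lepP => i; apply: mq; rewrite mem_enum.
by exists a => m q Um mq; apply: aP Um _.
Qed.

End Truncation.

(** * Powers of the irrelevant ideal and saturation *)

Section Saturation.
Variables (k : fieldType) (R : realType) (n r : nat) (F : fan R n r).
Implicit Types (m q : 'X_{1..r}) (s : {set 'I_r}) (J : ideal {mpoly k[r]}).
Local Notation Delta := (fan_cones F).
Local Notation B := (irrelevant_ideal k F).

Definition mhat s : 'X_{1..r} := [multinom (i \notin s : nat) | i < r].

Lemma xhatE s : xhat k s = 'X_[mhat s].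
Proof.
rewrite mpolyXE_id /xhat big_mkcond; apply: eq_bigr => i _.
by rewrite mnmE; case: (i \in s).
Qed.

(** The multiplicities [c] come from a product of [l] generators; only divisibility by each power
    separately is kept, which suffices for a pigeonhole argument. *)
Definition cone_monomials l m : Prop := exists c : {set 'I_r} -> nat,
  (\sum_(s in Delta) c s = l)%N /\ {in Delta, forall s i, (c s * mhat s i <= m i)%N}.

Lemma irrelevant_exp_support l :
  (ideal_exp B l `<=` mono_span (k := k) (cone_monomials l))%classic.
Proof.
elim: l => [|l IHl] x.
  move=> _ m _; exists m; last exact: lepm_refl.
  by exists (fun=> 0%N); split=> [|s _ i]; rewrite ?mul0n // big1.
apply; split=> [|z [x' [y [Bx /IHl Sy ->]]]]; first exact: mono_span_ideal.
have Sx : mono_span (k := k) (fun m => exists2 s, s \in Delta & m = mhat s) x'.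
  apply: Bx; split; first exact: mono_span_ideal.
  move=> _ [s sD <-] m; rewrite xhatE msuppX inE => /eqP->.
  by exists (mhat s); [exists s | apply: lepm_refl].
move=> m /msuppM_le /allpairsP[[m1 m2] /= [/Sx[_ [s sD ->] sm1] /Sy[q [c [cl cq]] qm2] ->]].
exists (mhat s + q)%MM; last first.
  by apply/mnm_lepP => i; rewrite !mnmDE leq_add // ?(mnm_lepP sm1) ?(mnm_lepP qm2).
exists (fun t => (t == s) + c t)%N; split=> [|t tD i].
  rewrite big_split /= cl (bigD1 s) //= eqxx big1 ?addn0 ?add1n // => t.
  by case/andP=> _ /negPf->.
rewrite mnmDE mulnDl leq_add ?cq //; case: eqP => [->|_]; by rewrite ?mul1n.
Qed.

(** Pigeonhole: among [#|Delta| * N + 1] generators some [xhat k s] occurs at least [N] times. The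
    exponent [l] is uniform in [J] and [x]. *)
Lemma colon_irrelevant N : exists l, forall J x,
  (forall s, s \in Delta -> ideal_set J (x * xhat k s ^+ N)) ->
  colon (ideal_set J) (ideal_exp B l) x.
Proof.
exists (#|Delta| * N).+1 => J x Jx y /irrelevant_exp_support Sy.
rewrite (mpolyE y) big_distrr /=; apply: ideal_sum => m /Sy[q [c [cl cq]] qm].
have [s [sD Ns]] : exists s, s \in Delta /\ (N <= c s)%N.
  apply: contrapT => nos; have : (\sum_(s in Delta) c s <= #|Delta| * N)%N.
    rewrite -sum_nat_const; apply: leq_sum => s sD; rewrite leqNgt.
    by apply/negP => /ltnW Ns; apply: nos; exists s.
  by rewrite cl ltnn.
have sm : (mhat s *+ N <= m)%MM.
  apply/mnm_lepP => i; rewrite mulmnE; apply: leq_trans (mnm_lepP qm i).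
  by apply: leq_trans (cq s sD i); rewrite mulnC leq_mul2r Ns orbT.
have [_ _ JM] := ideal_axiom J.
have -> : x * (y@_m *: 'X_[m]) =
    (y@_m *: 'X_[m - mhat s *+ N]) * (x * xhat k s ^+ N).
  by rewrite xhatE mpolyXn mulrCA -scalerAl -mpolyXD submK.
exact/JM/Jx.
Qed.

End Saturation.

Lemma in_saturation (S : comNzRingType) (J D : set S) l x :
  colon J (ideal_exp D l) x -> saturation J D x.
Proof. by move=> Jx; exists l. Qed.

(** Covers the case without any ray to choose as [rho]: the ring is then the field [k], and a proper
    ideal is zero. *)
Lemma pdim_le_no_vars (k : fieldType) (n r : nat) (J : ideal {mpoly k[r]}) :
  r = 0%N -> ~ ideal_set J 1 -> pdim_le (quot_mod J) n.
Proof.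
move=> r0 J1; apply: pdim_le_quot0 => x Jx.
have m0 (m : 'X_{1..r}) : m = 0%MM by apply/mnmP => i; have := ltn_ord i; rewrite [X in (_ < X)%N]r0.
have xE : x = (x@_0)%:MP by apply/mpolyP => m; rewrite (m0 m) mcoeffC eqxx mulr1.
apply: contrapT => /eqP; rewrite xE mpolyC_eq0 => x0; apply: J1.
have [_ _ JM] := ideal_axiom J.
have -> : 1 = (x@_0)^-1%:MP * x by rewrite {2}xE -mpolyCM mulVf.
exact: JM.
Qed.

Theorem theorem1p2 (R : realType) (k : fieldType) (n r : nat) (F : fan R n r)
    (I : ideal {mpoly k[r]}) :
  complete_fan F -> simplicial_fan F ->
  monomial_ideal I ->
  saturated I (irrelevant_ideal k F) ->
  non_irrelevant I (irrelevant_ideal k F) ->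
  exists J : ideal {mpoly k[r]},
    [/\ monomial_ideal J,
        ideal_set I = saturation J (irrelevant_ideal k F)
      & pdim_le (quot_mod J) n].
Proof.
move=> _ simpF monoI satI nirrI.
have [r0|r_gt0] := posnP r.
  exists I; split=> //; apply: pdim_le_no_vars => // I1.
  apply: (nirrI 0%N) => x _; have [_ _ IM] := ideal_axiom I.
  by rewrite -[x]mulr1; apply: IM.
pose rho : 'I_r := Ordinal r_gt0; pose Delta := fan_cones F; pose U := exponents I.
have upU : upward_closed U := @exponents_up _ _ I.
have [a Utrunc] := truncation_exists upU.
pose V m := U m /\ low a rho m \in Delta.
have Delta_down := simplicial_subset simpF.
have upV : upward_closed V.
  move=> m q mq [Um mD]; split; first exact: upU Um.
  exact: Delta_down mD (low_anti a rho mq).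
have [l colonB] := colon_irrelevant k F a.
exists (mono_ideal k V); split; first exact: mono_ideal_monomial.
- apply/seteqP; split=> x.
    (* Multiplying by the [a]-th power of [xhat k s] makes all exponents off [s] at least [a], so
       the low set lies in the cone [s]. *)
    move=> Ix; apply: (in_saturation (l := l)); apply: colonB => s sD.
    apply/mono_idealP => // m; rewrite xhatE mpolyXn (perm_mem (msuppMX _ _)).
    case/mapP => q xq ->; split.
      apply: (upU _ _ (lem_addl _ _)); move: Ix; rewrite (monomial_idealE monoI).
      by move=> /(mono_idealP _ upU); apply.
    apply: Delta_down sD _; apply/fintype.subsetP => i; rewrite !inE mnmDE mulmnE mnmE.
    by case: (i \in s); rewrite // mul1n ltnNge leq_addr andbF.
  move=> [l' _ Jx]; rewrite -satI; apply: (in_saturation (l := l')) => y /Jx /(mono_idealP _ upV) Vxy.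
  by apply: ideal_support => m /Vxy[].
apply: pdim_threshold => //.
- exact: simplicial_card.
- exact: fan_ray_mem.
- by move=> G; apply: fan_free_ridges.
(* If every cone failed to exclude [m], its products with all [a]-th powers of the [xhat k s] would
   lie in [I], and so would the monomial of [m] by saturation. *)
move=> m nUm; apply: contrapT => nos; apply: nUm.
rewrite /U /exponents -satI; apply: (in_saturation (l := l)); apply: colonB => s sD.
rewrite xhatE mpolyXn -mpolyXD; apply: contrapT => nI; apply: nos; exists s => // Us.
apply: nI; apply: Utrunc Us _ => i; rewrite mnmE mnmDE mulmnE mnmE.
by case: (i \in s); rewrite ?mul0n ?addn0 ?geq_minl // mul1n minnn leq_addl.
Qed.
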